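(* Let $\mathfrak q$ be a finite-dimensional Lie algebra over $\mathbb K$ with $[\mathfrak q,\mathfrak q]\neq 0$, and let $n\ge 2$. Suppose that $\mathrm{tr.deg}\,\mathcal S(\mathfrak q)^{\mathfrak q}=\mathrm{ind}\,\mathfrak q$ and that $\mathfrak q$ has the codim-2 property. Then for any monic polynomial $p\in\mathbb K[t]$ of degree $n$ and any nonzero $l\in\mathbb K[t]$ with $\deg l\le 1$, $$\mathrm{tr.deg}\,\mathcal Z(p,p+l)=\boldsymbol b(\mathfrak q,n).$$
   Context: $\mathbb K$ is an algebraically closed field of characteristic $0$. $\mathcal S(\mathfrak q)=\mathbb K[\mathfrak q^*]$ is the symmetric algebra with its Lie–Poisson bracket, and $\mathcal S(\mathfrak q)^{\mathfrak q}=\{H:\{H,x\}=0\ \forall x\in\mathfrak q\}$. For $\gamma\in\mathfrak q^*$, $\mathfrak q_\gamma=\{x\in\mathfrak q:\gamma([x,\mathfrak q])=0\}$; $\mathrm{ind}\,\mathfrak q=\min_{\gamma\in\mathfrak q^*}\dim\mathfrak q_\gamma$; $\mathfrak q^*_{\sf sing}=\{\gamma\in\mathfrak q^*:\dim\mathfrak q_\gamma>\mathrm{ind}\,\mathfrak q\}$. The codim-$k$ property means $\dim\mathfrak q^*_{\sf sing}\le\dim\mathfrak q-k$. Put $\boldsymbol b(\mathfrak q)=\frac12(\dim\mathfrak q+\mathrm{ind}\,\mathfrak q)$ and $\boldsymbol b(\mathfrak q,n)=(n-1)\boldsymbol b(\mathfrak q)+\mathrm{ind}\,\mathfrak q$.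 For a monic $p\in\mathbb K[t]$ of degree $n$, the Lie algebra $\mathfrak q[t]/(p)=\mathfrak q\otimes(\mathbb K[t]/(p))$ (with $[xf,yg]=[x,y]fg$) is identified, as a vector space, with $\mathbb W=\mathfrak q\cdot 1\oplus\mathfrak q\bar t\oplus\dots\oplus\mathfrak q\bar t^{\,n-1}$, $\bar t=t+(p)$. The resulting bracket on $\mathbb W$ is $[\,,]_p$, the corresponding Lie–Poisson bracket on $\mathcal S(\mathbb W)$ is $\{\,,\}_p$, and $\mathcal Z_p\subset\mathcal S(\mathbb W)$ is the Poisson centre of $(\mathcal S(\mathbb W),\{\,,\}_p)$. If $p_1\ne p_2$ are monic of degree $n$ with $\deg(p_1-p_2)\le 1$, then $\mathcal Z(p_1,p_2)\subset\mathcal S(\mathbb W)$ denotes the subalgebra generated by all $\mathcal Z_{ap_1+(1-a)p_2}$, $a\in\mathbb K$. *)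

(* Defs.v *)
From HB Require Import structures.
From mathcomp Require Import all_boot all_order all_algebra.
From mathcomp Require Import mpoly.
From mathcomp Require Import boolp.

Set Implicit Arguments.
Unset Strict Implicit.
Unset Printing Implicit Defensive.

Import GRing.Theory.
Local Open Scope ring_scope.

Section LieBracket.
Variables (K : fieldType) (V : vectType K).

(* The bracket is not bundled with V because one vector space carries a whole
   pencil of brackets. *)
Record is_lie_bracket (br : V -> V -> V) : Prop := IsLieBracket {
  lie_linearl : forall y, linear (br^~ y);
  lie_linearr : forall x, linear (br x);
  lie_alt : forall x, br x x = 0;
  lie_jacobi : forall x y z,
    br x (br y z) + br y (br z x) + br z (br x y) = 0
}.

Definition dual := 'Hom(V, K^o).

(* x |-> g [x, -] as a linear map V -> V^*; [linfun f] agrees with f when f is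
   linear, see [stabP]. *)
Definition ad_star (br : V -> V -> V) (g : dual) : 'Hom(V, dual) :=
  linfun (fun x => linfun (fun y => g (br x y)) : dual).

Definition stab (br : V -> V -> V) (g : dual) : {vspace V} :=
  lker (ad_star br g).

Lemma stabP (br : V -> V -> V) (g : dual) (x : V) : is_lie_bracket br ->
  reflect (forall y, g (br x y) = 0) (x \in stab br g).
Proof.
move=> hbr.
have inE z y : (linfun (fun y => g (br z y)) : dual) y = g (br z y).
  have lin : linear (fun y => g (br z y) : K^o).
    by move=> a u v; rewrite (lie_linearr hbr z a u v) linearP.
  pose L := GRing.isLinear.Build K V K^o *:%R (fun y => g (br z y)) lin.
  exact: (lfunE (HB.pack_for {linear V -> K^o} (fun y => g (br z y)) L)).
have outE z : ad_star br g z = linfun (fun y => g (br z y)).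
  have lin : linear (fun z => linfun (fun y => g (br z y)) : dual).
    move=> a u v; apply/lfunP=> y; rewrite add_lfunE scale_lfunE !inE.
    by rewrite (lie_linearl hbr y a u v) linearP.
  pose f z := linfun (fun y => g (br z y)) : dual.
  pose L := GRing.isLinear.Build K V dual *:%R f lin.
  exact: (lfunE (HB.pack_for {linear V -> dual} f L)).
rewrite memv_ker outE; apply: (iffP eqP) => [h y | h].
  by rewrite -inE h lfunE.
by apply/lfunP=> y; rewrite inE h lfunE.
Qed.

Lemma stab_dim_ex (br : V -> V -> V) :
  exists d, `[< exists g : dual, \dim (stab br g) = d >].
Proof. by exists (\dim (stab br 0)); apply/asboolP; exists 0. Qed.

Definition ind (br : V -> V -> V) : nat := ex_minn (stab_dim_ex br).

Definition sing (br : V -> V -> V) (g : dual) : Prop :=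
  (ind br < \dim (stab br g))%N.

(* S(V) = K[V^*], with 'X_i standing for the i-th vector of the fixed basis
   [vbasis fullv] of V. *)
Definition symalg := {mpoly K[\dim {:V}]}.

Definition basis_vec (i : 'I_(\dim {:V})) : V := (vbasis {:V})`_i.

Definition sym_incl (v : V) : symalg :=
  \sum_i coord (vbasis {:V}) i v *: 'X_i.

Definition sym_eval (F : symalg) (g : dual) : K :=
  F.@[fun i => g (basis_vec i)].

Definition poisson (br : V -> V -> V) (F G : symalg) : symalg :=
  \sum_i \sum_j
    F^`M(i) * G^`M(j) * sym_incl (br (basis_vec i) (basis_vec j)).

Definition sym_invariants (br : V -> V -> V) (H : symalg) : Prop :=
  forall x : V, poisson br H (sym_incl x) = 0.

Definition poisson_centre (br : V -> V -> V) (H : symalg) : Prop :=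
  forall F : symalg, poisson br H F = 0.

(* Algebraic independence of the restrictions F_1|_X, ..., F_k|_X in the
   coordinate ring K[X] of X. *)
Definition alg_indep_on (X : dual -> Prop) k (F : k.-tuple symalg) : Prop :=
  forall P : {mpoly K[k]},
    (forall g, X g -> P.@[fun i => sym_eval (tnth F i) g] = 0) -> P = 0.

(* dim X <= d, where the dimension of an affine algebraic set X is the
   transcendence degree of K[X]. The bound d is an integer because the empty
   set, for which even the family of length 0 is dependent (K[X] = 0), has
   dimension -oo. *)
Definition dim_le (X : dual -> Prop) (d : int) : Prop :=
  forall k (F : k.-tuple symalg), alg_indep_on X F -> (k%:Z <= d).

Definition codim_property (br : V -> V -> V) (k : nat) : Prop :=
  dim_le (sing br) ((\dim {:V})%:Z - k%:Z).

Definition b_lie (br : V -> V -> V) : rat :=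
  ((\dim {:V})%:R + (ind br)%:R) / 2%:R.

Definition b_lie_n (br : V -> V -> V) (n : nat) : rat :=
  (n%:R - 1) * b_lie br + (ind br)%:R.

End LieBracket.

Section TranscendenceDegree.
Variables (K : fieldType) (N : nat).

Definition alg_indep k (F : k.-tuple {mpoly K[N]}) : Prop :=
  forall P : {mpoly K[k]}, P \mPo F = 0 -> P = 0.

Definition has_trdeg (A : {mpoly K[N]} -> Prop) (d : nat) : Prop :=
  (exists F : d.-tuple {mpoly K[N]}, (forall i, A (tnth F i)) /\ alg_indep F)
  /\ (forall k (F : k.-tuple {mpoly K[N]}),
        (forall i, A (tnth F i)) -> alg_indep F -> (k <= d)%N).

Inductive gen_subalg (S : {mpoly K[N]} -> Prop) : {mpoly K[N]} -> Prop :=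
| gen_base F : S F -> gen_subalg S F
| gen_const c : gen_subalg S c%:MP
| gen_add F G : gen_subalg S F -> gen_subalg S G -> gen_subalg S (F + G)
| gen_mul F G : gen_subalg S F -> gen_subalg S G -> gen_subalg S (F * G).

End TranscendenceDegree.

Section Quotient.
Variables (K : fieldType) (q : vectType K) (br : q -> q -> q) (n : nat).

(* W = q.1 + q.t + ... + q.t^(n-1); w k is the coefficient of t^k. *)
Definition Wspace := {ffun 'I_n -> q}.

(* Since [x t^i, y t^j]_p = [x, y] t^(i+j), the coefficient of t^k is read off
   the remainder of 'X^(i+j) modulo p (p monic of degree n). *)
Definition br_mod (p : {poly K}) (u v : Wspace) : Wspace :=
  [ffun k : 'I_n =>
    \sum_(i < n) \sum_(j < n) ('X^(i + j) %% p)`_k *: br (u i) (v j)].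

Definition Zmod (p : {poly K}) : symalg Wspace -> Prop :=
  poisson_centre (br_mod p).

Definition Zpencil (p1 p2 : {poly K}) : symalg Wspace -> Prop :=
  gen_subalg (fun H => exists a : K, Zmod (a *: p1 + (1 - a) *: p2) H).

End Quotient.

(* Main.v *)
From HB Require Import structures.
Require Import Defs.
From mathcomp Require Import all_boot all_order all_algebra.
From mathcomp Require Import fingroup perm separable mpoly boolp ring zify.

Set Implicit Arguments.
Unset Strict Implicit.
Unset Printing Implicit Defensive.

Import GRing.Theory.
Local Open Scope ring_scope.

(** Let N = dim q, r = ind q, R = N - r and m = dim W = n N. As deg l <= 1,
    the bracket of q[t]/(p + c l) depends on c in an affine way
    ([gram_pencil]), so at a point x of the dual of W the Lie-Poisson forms
    make a pencil A + c B of skew forms on W. In characteristic 0 the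
    transcendence degree of an algebra of polynomials is the generic rank of
    the differentials of its elements ([alg_indep_jac], [jac_alg_indep]). A
    function that is central for the bracket with parameter c has its
    differential at x in ker (A + c B). Conversely, if p + c l has distinct
    roots, q[t]/(p + c l) is a sum of n copies of q; since S(q) has ind q
    independent invariants, the differentials of the central functions fill
    ker (A + c B) at a general point. The transcendence degree is therefore
    the generic dimension of the sum L of the kernels of the members A + c B.
    What has to be shown is that 2 dim L = 2 m - n R - R.

    Generically A + c B has rank n R. The constants q.1 lie in the kernel of B,
    the member at infinity, and A has rank R on them. The space L is isotropic
    ([pencil_isotropic]) and orthogonal to the constants, which gives the
    inequality <= ([isotropic_rank_le]). For the other inequality, split off
    a part of the constants on which A is nondegenerate. If A + c B has rank
    n R for every c and B has rank at least (n - 1) R, what remains is a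
    pencil of constant rank along the projective line. For such a pencil the
    quotient of the orthogonal of L by L carries a pencil of forms which are
    all nondegenerate, so it vanishes ([regular_pencil_rank]). This is the
    part of the Jordan-Kronecker theory of pencils that is needed.

    It remains to find a point x where the ranks are as required for every c,
    and this is where the codimension enters. Let v be regular in the dual of
    q. The set of singular elements has codimension at least 2 and is stable
    under scalars, so for general u the plane spanned by u and v meets it at
    most in 0 ([regular_lines]). Let x be the point
    y f |-> f_(n-1) u(y) + (f_0 + mu f_1) v(y). In suitable bases made of
    partial products of the linear factors of p + c l, the form A + c B is
    block triangular, and its diagonal blocks are Lie-Poisson forms of q at
    points of the line u + K v ([gram_mod_rank_ge]); B is block triangular as
    well, with blocks at one nonzero point of the plane ([gram_lim_rank_ge]).
    So all the blocks have rank R. *)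

(** * Ranks, minors and matrices of polynomials in one parameter *)

Section Matrices.
Variable K : fieldType.

Lemma row_free_of_ker k n (A : 'M[K]_(k, n)) :
  (forall c : 'rV_k, c *m A = 0 -> c = 0) -> row_free A.
Proof.
move=> h; rewrite -kermx_eq0; apply/eqP/row_matrixP => i.
by rewrite row0; apply: h; rewrite -row_mul mulmx_ker row0.
Qed.

Lemma row_free_sub k m n (A : 'M[K]_(m, n)) : (k <= \rank A)%N ->
  exists2 Y : 'M_(k, n), row_free Y & (Y <= A)%MS.
Proof.
move=> le_kA; exists (pid_mx k *m row_base A).
  by rewrite /row_free mxrankMfree ?row_base_free // rank_pid_mx.
by rewrite (submx_trans (submxMl _ _)) // eq_row_base.
Qed.

Lemma rank_unit_minor k m n (A : 'M[K]_(m, n)) : (k <= \rank A)%N ->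
  exists (C : 'M_(k, m)) (D : 'M_(n, k)), C *m A *m D = 1%:M.
Proof.
move=> /row_free_sub[Y Yfree /submxP[C defY]].
have [D YD] := row_freeP Yfree; exists C, D.
by rewrite -defY.
Qed.

Lemma unit_minor_rank k m n (A : 'M[K]_(m, n)) (C : 'M_(k, m)) (D : 'M_(n, k)) :
  C *m A *m D \in unitmx -> (k <= \rank A)%N.
Proof.
move=> u; rewrite -(mxrank_unit u).
by rewrite (leq_trans (mxrankM_maxl _ _)) ?mxrankM_maxr.
Qed.

(** The row space of C lies in its double annihilator, which has the same
    dimension. *)
Lemma sub_double_annihilator k m n (C : 'M[K]_(m, n)) (X : 'M_(k, n)) :
  X *m (kermx C^T)^T = 0 -> (X <= C)%MS.
Proof.
move=> XK.
have CK : C *m (kermx C^T)^T = 0.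
  by apply: trmx_inj; rewrite trmx_mul trmxK mulmx_ker trmx0.
have sCK : (C <= kermx (kermx C^T)^T)%MS by apply/sub_kermxP.
have : \rank (kermx (kermx C^T)^T) = \rank C.
  by rewrite mxrank_ker mxrank_tr mxrank_ker mxrank_tr subKn ?rank_leq_col.
move=> rk; have /eqmxP eqC : (C == kermx (kermx C^T)^T)%MS.
  by rewrite -(mxrank_leqif_eq sCK) rk.
by rewrite eqC; apply/sub_kermxP.
Qed.

(** A matrix is determined by rows and columns that meet in an invertible
    minor of maximal size: such rows C A already span the row space of A, so
    A = Y (C A), and multiplying by D gives Y. *)
Lemma unit_minor_mul k m n (A : 'M[K]_(m, n)) (C : 'M_(k, m)) (D : 'M_(n, k)) :
  C *m A *m D \in unitmx -> (\rank A <= k)%N ->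
  A *m D *m invmx (C *m A *m D) *m (C *m A) = A.
Proof.
move=> uX rA.
have sCA : (C *m A <= A)%MS by apply: submxMl.
have rCA : \rank (C *m A) = \rank A.
  apply/eqP; rewrite eqn_leq mxrankS //= (leq_trans rA) //.
  by apply: leq_trans (mxrankM_maxl (C *m A) D); rewrite (mxrank_unit uX).
have /eqmxP eqCA : (C *m A == A)%MS by rewrite -(mxrank_leqif_eq sCA) rCA.
have /submxP[Y defA] : (A <= C *m A)%MS by rewrite eqCA.
have -> : A *m D *m invmx (C *m A *m D) = Y.
  by rewrite {1}defA -(mulmxA Y (C *m A)) -mulmxA mulmxV // mulmx1.
by rewrite -defA.
Qed.

End Matrices.

Section HornerMx.
Variable K : fieldType.
Local Notation hev s := (map_mx (horner_eval s)).

Lemma size_det_leq n (A : 'M[{poly K}]_n) :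
  (forall i j, size (A i j) <= 2)%N -> (size (\det A) <= n.+1)%N.
Proof.
move=> hA; rewrite /determinant.
apply: (leq_trans (size_sum _ _ _)); apply/bigmax_leqP => s _.
rewrite mulr_sign.
have h : (size (\prod_i A i (s i))%R <= n.+1)%N.
  apply: leq_trans (size_prod_leq _ _) _.
  rewrite leq_subLR (leq_trans (n := (\sum_(i < n) 2).+1)) //.
    by rewrite ltnS leq_sum // => i _; apply: hA.
  by rewrite sum_nat_const !card_ord muln2 -addnn -addnS.
by case: ifP => _; rewrite ?size_polyN.
Qed.

Lemma size_adj_leq n (A : 'M[{poly K}]_n) i j :
  (forall i j, size (A i j) <= 2)%N -> (size ((\adj A) i j) <= n)%N.
Proof.
case: n A i j => [|n] A i j hA; first by case: i.
rewrite mxE /cofactor.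
have h : (size (\det (row' j (col' i A))) <= n.+1)%N.
  by apply: size_det_leq => a b; rewrite !mxE; apply: hA.
by rewrite -signr_odd mulr_sign; case: ifP => _; rewrite ?size_polyN.
Qed.

Lemma size_mulmx_leq m n q a b (A : 'M[{poly K}]_(m, n)) (B : 'M[{poly K}]_(n, q)) :
  (forall i j, size (A i j) <= a.+1)%N ->
  (forall i j, size (B i j) <= b.+1)%N ->
  forall i j, (size ((A *m B) i j) <= (a + b).+1)%N.
Proof.
move=> hA hB i j; rewrite mxE.
apply: (leq_trans (size_sum _ _ _)); apply/bigmax_leqP => k _.
apply: leq_trans (size_polyMleq _ _) _.
move: (hA i k) (hB k j).
move: (size (A i k)) (size (B k j)) => x y; by lia.
Qed.

Lemma horner_mxC s m n (C : 'M[K]_(m, n)) : hev s (map_mx polyC C) = C.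
Proof. by apply/matrixP => i j; rewrite !mxE /horner_eval hornerC. Qed.

Lemma horner_mx0 s m n : hev s (0 : 'M[{poly K}]_(m, n)) = 0.
Proof. by apply/matrixP => i j; rewrite !mxE /horner_eval horner0. Qed.

Lemma poly_eq0_roots (f : {poly K}) (S : seq K) :
  uniq S -> (size f <= size S)%N -> (forall s, s \in S -> f.[s] = 0) -> f = 0.
Proof.
move=> uS leS h; apply: contraTeq leS => nz; rewrite -ltnNge.
by apply: max_poly_roots => //; apply/allP => s /h; rewrite /root => ->.
Qed.

End HornerMx.

Section CharZero.
Variable K : fieldType.
Hypothesis charK : [pchar K] =i pred0.

Lemma natr_inj_char0 : injective (fun k : nat => k%:R : K).
Proof.
have charK0 := (pcharf0P K).1 charK.
have h a b : (a <= b)%N -> a%:R = b%:R :> K -> a = b.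
  move=> le e; apply/eqP; rewrite eqn_leq le /= -subn_eq0 -charK0.
  by rewrite natrB // e subrr.
move=> a b; case: (leqP a b) => [le | /ltnW le] /= e; first exact: h.
by apply/esym/h.
Qed.

(** A field of characteristic 0 contains the natural numbers. *)
Lemma many_scalars k (T : seq K) :
  exists S : seq K, [/\ uniq S, size S = k & {in S, forall s, s \notin T}].
Proof.
pose C := map (fun k : nat => k%:R : K) (iota 0 (k + size T)).
have uC : uniq C by rewrite map_inj_uniq ?iota_uniq //; apply: natr_inj_char0.
exists (take k [seq s <- C | s \notin T]); split.
- by rewrite take_uniq // filter_uniq.
- rewrite size_takel // size_filter -(leq_add2r (count (mem T) C)).
  have -> : count (fun s => s \notin T) C = (size C - count (mem T) C)%N.
    by rewrite -(count_predC (mem T) C) addKn.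
  rewrite subnK ?count_size // size_map size_iota leq_add2l.
  rewrite -size_filter; apply: uniq_leq_size; first exact: filter_uniq.
  by move=> x; rewrite mem_filter => /andP[].
- by move=> s /mem_take; rewrite mem_filter => /andP[].
Qed.

Lemma poly_eq0_cofinite (f : {poly K}) (T : seq K) :
  (forall s, s \notin T -> f.[s] = 0) -> f = 0.
Proof.
move=> h; have [S [uS sS ST]] := many_scalars (size f) T.
by apply: (poly_eq0_roots uS) => [|s /ST/h//]; rewrite sS.
Qed.

Lemma polymx_eq0_cofinite m n (F : 'M[{poly K}]_(m, n)) (T : seq K) :
  (forall s, s \notin T -> map_mx (horner_eval s) F = 0) -> F = 0.
Proof.
move=> h; apply/matrixP => i j; rewrite mxE; apply: (@poly_eq0_cofinite _ T) => s /h.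
by move/matrixP/(_ i j); rewrite !mxE.
Qed.

Section Path.
Variables (m : nat) (A B : 'M[K]_m).
Local Notation P s := (A + s *: B).
Local Notation hev s := (map_mx (horner_eval s)).
Let PX : 'M[{poly K}]_m := map_mx polyC A + 'X *: map_mx polyC B.

Let hevPX s : hev s PX = P s.
Proof. by apply/matrixP => i j; rewrite !mxE /horner_eval !hornerE. Qed.

Let size_PX i j : (size (PX i j) <= 2)%N.
Proof.
rewrite !mxE; apply: leq_trans (size_polyD _ _) _.
rewrite geq_max (leq_trans (size_polyC_leq1 _)) //=.
rewrite (leq_trans (size_polyMleq _ _)) // size_polyX.
by have := size_polyC_leq1 (B i j); lia.
Qed.

(** A minor that is nonzero at s is a nonzero polynomial in the parameter,
    hence nonzero for almost all parameters: the rank cannot jump up at s. *)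
Lemma pencil_rank_le rho (T : seq K) :
  (forall s, s \notin T -> (\rank (P s) <= rho)%N) ->
  forall s, (\rank (P s) <= rho)%N.
Proof.
move=> h s; rewrite leqNgt; apply/negP => /rank_unit_minor[C [D CD]].
pose d := \det (map_mx polyC C *m PX *m map_mx polyC D).
have dE t : d.[t] = \det (C *m P t *m D).
  by rewrite -/(horner_eval t d) /d -det_map_mx !map_mxM /= hevPX !horner_mxC.
have : d = 0.
  apply: (@poly_eq0_cofinite _ T) => t /h; rewrite dE; apply: contraTeq => nz.
  rewrite -ltnNge; apply: (@unit_minor_rank _ _ _ _ _ C D).
  by rewrite unitmxE unitfE.
move/(congr1 (fun f => f.[s])); rewrite dE CD det1 horner0 => /eqP.
by rewrite oner_eq0.
Qed.

(** A kernel vector of P(s0) moves in a polynomial family of kernel vectors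
    of P(s) as long as the rank does not drop at s0. If X = C P D is a minor
    with X(s0) = 1, Cramer's rule gives the family
    V = det X - P D adj(X) C: wherever X is invertible, [unit_minor_mul]
    says that V P = 0, and at s0 the matrix V = 1 - P D C fixes the left
    kernel of P. The degree bound is what lets finitely many parameters
    suffice in [pencil_limit]. *)
Lemma kernel_path rho s0 :
  (forall s, (\rank (P s) <= rho)%N) -> (rho <= \rank (P s0))%N ->
  exists V : 'M[{poly K}]_m,
    [/\ forall i j, (size (V i j) <= m.+1)%N,
        forall s, hev s V *m P s = 0 &
        forall k (w : 'M_(k, m)), w *m P s0 = 0 -> w *m hev s0 V = w].
Proof.
move=> rP r0; have [C [D CD]] := rank_unit_minor r0.
have le_rho : (rho <= m)%N by apply: leq_trans r0 (rank_leq_row _).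
pose X := map_mx polyC C *m PX *m map_mx polyC D.
have hX s : hev s X = C *m P s *m D by rewrite !map_mxM /= hevPX !horner_mxC.
have size_cst k n (E : 'M[K]_(k, n)) i j : (size (map_mx polyC E i j) <= 1)%N.
  by rewrite mxE size_polyC_leq1.
have size_X i j : (size (X i j) <= 2)%N.
  apply: (@size_mulmx_leq _ _ _ _ 1 0) => // a b.
  exact: (@size_mulmx_leq _ _ _ _ 0 1).
pose V := (\det X)%:M - PX *m map_mx polyC D *m \adj X *m map_mx polyC C.
have hV s : hev s V = (\det (C *m P s *m D))%:M
    - P s *m D *m \adj (C *m P s *m D) *m C.
  rewrite map_mxB /= map_scalar_mx !map_mxM /= map_mx_adj hX hevPX !horner_mxC.
  by rewrite -det_map_mx /= hX.
exists V; split.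
- move=> i j; rewrite mxE [(- _ : 'M_m) i j]mxE.
  apply: leq_trans (size_polyD _ _) _; rewrite size_polyN geq_max; apply/andP; split.
    rewrite mxE; case: eqP => _; rewrite ?mulr0n ?size_poly0 // mulr1n.
    by apply: leq_trans (size_det_leq _) _.
  case: (posnP rho) => [rho0 | rho_gt0].
    have -> : map_mx polyC C = 0 :> 'M_(rho, m).
      by apply/matrixP => -[k lt_k]; exfalso; move: lt_k; rewrite rho0.
    by rewrite mulmx0 mxE size_poly0.
  have : (size ((PX *m map_mx polyC D *m \adj X *m map_mx polyC C) i j) <= (1 + rho.-1 + 0).+1)%N.
    apply: size_mulmx_leq => // a b; apply: size_mulmx_leq => [c d|c d].
      exact: (@size_mulmx_leq _ _ _ _ 1 0).
    by rewrite prednK //; apply: size_adj_leq.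
  by move=> h; apply: leq_trans h _; move: rho_gt0 le_rho; clear; lia.
- have VP : (\det X)%:M *m (V *m PX) = 0.
    apply: (@polymx_eq0_cofinite _ _ _ [::]) => s _.
    rewrite !map_mxM /= hevPX map_scalar_mx hV mul_scalar_mx.
    rewrite -/(horner_eval s (\det X)) -det_map_mx /= hX.
    set Y := C *m P s *m D.
    case: (eqVneq (\det Y) 0) => [-> | nz]; first by rewrite scale0r.
    have uY : Y \in unitmx by rewrite unitmxE unitfE.
    rewrite -[RHS](scaler0 _ (\det Y)); congr (_ *: _).
    rewrite mulmxBl mul_scalar_mx -(mulmxA _ C).
    rewrite -{1}(unit_minor_mul uY (rP s)).
    rewrite /invmx uY -scalemxAr -scalemxAl scalerA mulfV // scale1r subrr //.
  have nz : \det X != 0.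
    apply/eqP => /(congr1 (horner_eval s0)).
    rewrite -det_map_mx /= hX CD det1 /horner_eval horner0 => /eqP.
    by rewrite oner_eq0.
  have {}VP : V *m PX = 0.
    move: VP; rewrite mul_scalar_mx => /eqP.
    by rewrite scalemx_eq0 (negPf nz) /= => /eqP.
  move=> s; rewrite -hevPX -map_mxM /= VP; apply: horner_mx0.
- move=> k w w0; rewrite hV CD det1 adj1 mulmxBr mul_mx_scalar scale1r.
  by rewrite !mulmxA w0 !mul0mx subr0.
Qed.
End Path.
End CharZero.

(** * Pencils of skew forms *)

Lemma row_free_eq0 (K : fieldType) k m n (A : 'M[K]_(m, n)) (y : 'M_(k, m)) :
  row_free A -> y *m A = 0 -> y = 0.
Proof. by move=> Afree yA; apply: (row_free_injr Afree); rewrite /= yA mul0mx. Qed.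

Section SeqSums.
Variables (K : fieldType) (m : nat) (I : eqType) (S : seq I) (F : I -> 'M[K]_m).

Lemma seq_sumsmx_sup i : i \in S -> (F i <= \sum_(s <- S) F s)%MS.
Proof.
by rewrite big_tnth => /seq_tnthP[j ->]; apply: (sumsmx_sup j).
Qed.

Lemma seq_sumsmx_sub k (X : 'M_(k, m)) :
  {in S, forall s, (F s <= X)%MS} -> (\sum_(s <- S) F s <= X)%MS.
Proof.
by move=> h; rewrite big_tnth; apply/sumsmx_subP => j _; apply/h/mem_tnth.
Qed.
End SeqSums.

Section Pencil.
Variables (K : fieldType) (charK : [pchar K] =i pred0) (m : nat).
Implicit Types A B C : 'M[K]_m.
Local Notation hev s := (map_mx (horner_eval s)).

Lemma skew_ker A k (w : 'M_(k, m)) : A^T = - A -> w *m A = 0 -> A *m w^T = 0.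
Proof.
by move=> skA h; apply: trmx_inj; rewrite trmx_mul trmxK skA mulmxN h oppr0 trmx0.
Qed.

(** When s and s' differ, both A + s B and A + s' B vanish on (w, w'), hence
    so does their difference (s - s') B. When they agree, move w along the
    path of [kernel_path]: B vanishes on it away from s, hence also at s. *)
Lemma pencil_isotropic A B rho s s' k k' (w : 'M_(k, m)) (w' : 'M_(k', m)) :
  A^T = - A -> B^T = - B ->
  (forall s, (\rank (A + s *: B)%R <= rho)%N) -> (rho <= \rank (A + s *: B)%R)%N ->
  w *m (A + s *: B) = 0 -> w' *m (A + s' *: B) = 0 -> w *m B *m w'^T = 0.
Proof.
move=> skA skB rP rs ws ws'.
have skP t : (A + t *: B)^T = - (A + t *: B).
  by rewrite linearD linearZ /= skA skB scalerN opprD.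
have orth t l (v : 'M_(l, m)) : t != s' -> v *m (A + t *: B) = 0 ->
    v *m B *m w'^T = 0.
  move=> nt vt; apply/eqP.
  have /negPf nz : t - s' != 0 by rewrite subr_eq0.
  suff : (t - s') *: (v *m B *m w'^T) == 0 by rewrite scalemx_eq0 nz.
  have -> : (t - s') *: (v *m B *m w'^T) =
      v *m (A + t *: B) *m w'^T - v *m ((A + s' *: B) *m w'^T).
    rewrite mulmxA -mulmxBl -mulmxBr opprD addrACA subrr add0r -scalerBl.
    by rewrite -scalemxAr -scalemxAl.
  by rewrite vt (skew_ker (skP _) ws') mul0mx mulmx0 subrr.
have [V [_ VP Vw]] := kernel_path charK rP rs.
have F0 : map_mx polyC w *m V *m map_mx polyC (B *m w'^T) = 0.
  apply: (polymx_eq0_cofinite charK (T := [:: s'])) => t; rewrite inE => nt.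
  rewrite !map_mxM /= !horner_mxC mulmxA; apply: orth nt _.
  by rewrite -mulmxA VP mulmx0.
have := congr1 (hev s) F0; rewrite !map_mxM /= !horner_mxC Vw // mulmxA => ->.
exact: horner_mx0.
Qed.

(** The path of [kernel_path] through a kernel vector at s0 is a polynomial
    of degree at most m; it lies in L for more than m parameters, so it lies
    in L at s0 too. *)
Lemma pencil_limit A B rho s0 (S : seq K) k (L : 'M_(k, m)) :
  (forall s, (\rank (A + s *: B)%R <= rho)%N) -> (rho <= \rank (A + s0 *: B)%R)%N ->
  uniq S -> (m < size S)%N ->
  {in S, forall s, (kermx (A + s *: B) <= L)%MS} -> (kermx (A + s0 *: B)%R <= L)%MS.
Proof.
move=> rP r0 uS sS SL; have [V [sV VP Vw]] := kernel_path charK rP r0.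
set w := kermx _; rewrite submxE -(Vw _ w) ?mulmx_ker //.
suff F0 : V *m map_mx polyC (cokermx L) = 0.
  have := congr1 (hev s0) F0; rewrite map_mxM /= horner_mxC -mulmxA => ->.
  by rewrite horner_mx0 mulmx0.
apply/matrixP => i j; rewrite [RHS]mxE; apply: (poly_eq0_roots uS) => [|s sinS].
  apply: leq_trans sS; apply: leq_trans (size_mulmx_leq (a := m) (b := 0) _ _ i j) _ => //.
    by move=> a b; rewrite mxE size_polyC_leq1.
  by rewrite addn0.
have : hev s (V *m map_mx polyC (cokermx L)) = 0.
  rewrite map_mxM /= horner_mxC; apply/eqP; rewrite -submxE.
  by apply: submx_trans (SL s sinS); apply/sub_kermxP.
by move/matrixP/(_ i j); rewrite !mxE.
Qed.

Lemma rank_orth C k (L : 'M_(k, m)) : C^T = - C -> (kermx C <= L)%MS ->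
  \rank (kermx (C *m L^T)) = (m - \rank L + (m - \rank C))%N.
Proof.
move=> skC kL; rewrite mxrank_ker.
have -> : \rank (C *m L^T) = \rank (L *m C).
  by rewrite -mxrank_tr trmx_mul trmxK skC mulmxN mxrank_opp.
have := mxrank_mul_ker L C.
have -> : \rank (L :&: kermx C)%MS = (m - \rank C)%N.
  by rewrite (capmx_idPr kL) mxrank_ker.
have := rank_leq_col L; have := rank_leq_row C; have := rank_leq_col (L *m C).
lia.
Qed.

(** Double orthogonality for a degenerate form: the orthogonal of the
    orthogonal of L is L + ker C. *)
Lemma skew_double_orth C k n l (L : 'M_(k, m)) (Z : 'M_(l, m)) (z : 'M_(n, m)) :
  C^T = - C -> (kermx C <= L)%MS -> (kermx (C *m L^T) <= Z)%MS ->
  z *m C *m Z^T = 0 -> (z <= L)%MS.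
Proof.
move=> skC kL kZ zCZ.
have /sub_double_annihilator/submxP[Y zC] : z *m C *m (kermx (L *m C)^T)^T = 0.
  have sZ : (kermx (L *m C)^T <= Z)%MS.
    apply: submx_trans kZ; apply/sub_kermxP.
    have -> : C *m L^T = - (L *m C)^T by rewrite trmx_mul skC mulNmx opprK.
    by rewrite mulmxN mulmx_ker oppr0.
  have /submxP[D ->] := sZ.
  by rewrite trmx_mul mulmxA zCZ mul0mx.
have -> : z = (z - Y *m L) + Y *m L by rewrite subrK.
rewrite addmx_sub ?submxMl // (submx_trans _ kL) //.
by apply/sub_kermxP; rewrite mulmxBl zC mulmxA subrr.
Qed.

End Pencil.

Section Kronecker.
Variables (K : closedFieldType) (charK : [pchar K] =i pred0) (m : nat).
Implicit Types A B C : 'M[K]_m.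

Lemma eigenvalue_ex n (M : 'M[K]_n) : (0 < n)%N -> exists a, eigenvalue M a.
Proof.
move=> n_gt0; have /closed_rootP[a ra] : size (char_poly M) != 1%N.
  by rewrite size_char_poly eqSS -lt0n.
by exists a; rewrite eigenvalue_root_char.
Qed.

(** Orthogonality to a vector w of some kernel does not depend on the member
    of the pencil: the members differ from the one that kills w by multiples
    of B. *)
Lemma pencil_orth A B s s' k k' (z : 'M_(k, m)) (w : 'M_(k', m)) :
  A^T = - A -> B^T = - B -> z *m B *m w^T = 0 -> w *m (A + s' *: B) = 0 ->
  z *m (A + s *: B) *m w^T = 0.
Proof.
move=> skA skB zw ws'.
have skP t : (A + t *: B)^T = - (A + t *: B).
  by rewrite linearD linearZ /= skA skB scalerN opprD.
have -> : A + s *: B = (A + s' *: B) + (s - s') *: B.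
  by rewrite -addrA -scalerDl (addrC s') subrK.
rewrite mulmxDr mulmxDl -mulmxA (skew_ker (skP s') ws') mulmx0 add0r.
by rewrite -scalemxAr -scalemxAl zw scaler0.
Qed.

(** The case of constant rank along the whole projective line (B being the
    member at infinity). The sum L of the kernels at the points of S contains
    all kernels, by [pencil_limit], and is isotropic for the whole pencil; its
    orthogonal Z is the same for all members. A member has its kernel in L,
    so it induces a nondegenerate form on Z / L. But two nondegenerate forms
    over an algebraically closed field have a degenerate combination, given
    by an eigenvalue of a b^-1, unless Z / L = 0; and Z = L is a statement
    about dimensions. *)
Lemma regular_pencil_rank A B rho (S : seq K) :
  A^T = - A -> B^T = - B -> (forall s, \rank (A + s *: B)%R = rho) ->
  \rank B = rho -> uniq S -> 0 \notin S -> (m < size S)%N ->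
  (m + (m - rho) <= 2 * \rank (\sum_(s <- S) kermx (A + s *: B)%R)%MS)%N.
Proof.
move=> skA skB rP rB uS S0 sS; set L := (\sum_(s <- S) _)%MS.
have skP s : (A + s *: B)^T = - (A + s *: B).
  by rewrite linearD linearZ /= skA skB scalerN opprD.
have rPle s : (\rank (A + s *: B)%R <= rho)%N by rewrite rP.
have rPge s : (rho <= \rank (A + s *: B)%R)%N by rewrite rP.
have SL : {in S, forall s, (kermx (A + s *: B) <= L)%MS}.
  by move=> s; apply: seq_sumsmx_sup.
have PL s : (kermx (A + s *: B) <= L)%MS.
  exact: pencil_limit rPle (rPge s) uS sS SL.
have BL : (kermx B <= L)%MS.
  have swapE s : s != 0 -> B + s^-1 *: A = s^-1 *: (A + s *: B).
    by move=> nz; rewrite scalerDr scalerA mulVf // scale1r addrC.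
  (* The same pencil seen from infinity, where the parameter is s^-1. *)
  have rP' s : (\rank (B + s *: A)%R <= rho)%N.
    case: (eqVneq s 0) => [->|nz]; first by rewrite scale0r addr0 rB.
    by rewrite -[s]invrK swapE ?invr_eq0 // (leq_trans (mxrank_scale _ _)).
  have := @pencil_limit _ charK m B A rho 0 (map GRing.inv S) _ L rP'.
  rewrite scale0r addr0 rB size_map => /(_ (leqnn _)); apply => //.
    by rewrite map_inj_uniq //; apply: invr_inj.
  move=> _ /mapP[s sinS ->]; have nz : s != 0 by apply: contraNneq S0 => <-.
  apply: submx_trans (SL s sinS); rewrite swapE //.
  apply/sub_kermxP; have := mulmx_ker (s^-1 *: (A + s *: B)).
  rewrite -scalemxAr => /eqP; rewrite scalemx_eq0 invr_eq0 (negPf nz) /=.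
  by move/eqP.
have isoB : L *m B *m L^T = 0.
  rewrite -mulmxA; apply/sub_kermxP; apply: seq_sumsmx_sub => s _.
  apply/sub_kermxP; rewrite mulmxA.
  have tr (X : 'M_m) : X *m B *m L^T = - (L *m B *m X^T)^T.
    by rewrite !trmx_mul trmxK skB mulNmx mulmxN opprK mulmxA.
  rewrite tr.
  suff -> : L *m B *m (kermx (A + s *: B))^T = 0 by rewrite trmx0 oppr0.
  rewrite -mulmxA; apply/sub_kermxP; apply: seq_sumsmx_sub => s' _.
  apply/sub_kermxP; rewrite mulmxA.
  exact: pencil_isotropic skA skB rPle (rPge s') (mulmx_ker _) (mulmx_ker _).
pose Z := kermx (B *m L^T).
have LZ : (L <= Z)%MS by apply/sub_kermxP; rewrite mulmxA.
have rZ : \rank Z = (m - \rank L + (m - rho))%N by rewrite rank_orth // rB.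
have ZL k (z : 'M_(k, m)) s : (z <= Z)%MS -> z *m (A + s *: B) *m L^T = 0.
  move=> /sub_kermxP; rewrite mulmxA => zB.
  apply: trmx_inj; rewrite trmx_mul trmxK trmx0; apply/sub_kermxP.
  apply: seq_sumsmx_sub => s' s'S; apply/sub_kermxP.
  apply: trmx_inj; rewrite trmx_mul trmxK trmx0.
  apply: pencil_orth skA skB _ (mulmx_ker (A + s' *: B)).
  have /submxP[D ->] := SL s' s'S.
  by rewrite trmx_mul mulmxA zB mul0mx.
have rle := rank_leq_col L.
rewrite leqNgt; apply/negP => lt_L.
have u_gt0 : (0 < \rank (Z :\: L)%MS)%N.
  have := mxrank_cap_compl Z L; rewrite rZ.
  have := mxrankS (capmxSr Z L); move: lt_L rle; clear; lia.
have [U [Ufree eqU]] : exists U : 'M_(\rank (Z :\: L)%MS, m),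
    row_free U /\ (U :=: Z :\: L)%MS.
  by exists (row_base (Z :\: L)%MS); split; [apply: row_base_free|apply: eq_row_base].
have UZ : (U <= Z)%MS by rewrite eqU diffmxSl.
have UL0 k (y : 'M_(k, _)) : (y *m U <= L)%MS -> y = 0.
  move=> yL; apply: (row_free_eq0 Ufree); apply/eqP; rewrite -submx0.
  have <- : ((Z :\: L) :&: L)%MS = 0 by apply: capmx_diff.
  by rewrite sub_capmx yL -eqU submxMl.
have nondeg C k (y : 'M_(k, _)) : C^T = - C -> \rank C = rho -> (kermx C <= L)%MS ->
    (forall l (z : 'M_(l, m)), (z <= Z)%MS -> z *m C *m L^T = 0) ->
    y *m (U *m C *m U^T) = 0 -> y = 0.
  move=> skC rC CL ZC yUCU; apply: UL0.
  have eqZ : (kermx (C *m L^T) == Z)%MS.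
    have sZ : (Z <= kermx (C *m L^T))%MS by apply/sub_kermxP; rewrite mulmxA ZC.
    by rewrite andbC -(mxrank_leqif_eq sZ) rZ (rank_orth skC CL) rC.
  apply: (skew_double_orth skC CL (Z := Z)); first by case/andP: eqZ.
  have /sub_addsmxP[[D1 D2] /= defZ] : (Z <= U + L)%MS.
    rewrite -(addsmx_diff_cap_eq Z L) addsmxS ?capmxSr //.
    by rewrite eqU.
  suff : y *m U *m C *m (D1 *m U + D2 *m L)^T = 0 by rewrite -defZ.
  rewrite linearD /= !trmx_mul mulmxDr !mulmxA ZC; last first.
    by apply: submx_trans UZ; apply: submxMl.
  by rewrite mul0mx addr0 -(mulmxA y) -(mulmxA y) yUCU mul0mx.
pose a := U *m A *m U^T; pose b := U *m B *m U^T.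
have ub : b \in unitmx.
  rewrite -row_free_unit; apply: row_free_of_ker => y yb.
  apply: (nondeg B _ y) => // l z /sub_kermxP; by rewrite mulmxA.
have [t /eigenvalueP[y yt /negP[]]] := eigenvalue_ex (a *m invmx b) u_gt0.
apply/eqP/(nondeg (A + (- t) *: B)) => //; first by move=> l z; apply: ZL.
rewrite mulmxDr mulmxDl mulmxDr -/a -scalemxAr -scalemxAl -/b.
have -> : a = a *m invmx b *m b by rewrite mulmxKV.
by rewrite (mulmxA y) yt -scalemxAl -scalemxAr -scalerDl subrr scale0r.
Qed.
End Kronecker.


Section Reduction.
Variables (K : closedFieldType) (charK : [pchar K] =i pred0) (m : nat).
Implicit Types A B : 'M[K]_m.

Lemma skew_congr A n (Q : 'M_(n, m)) :
  A^T = - A -> (Q *m A *m Q^T)^T = - (Q *m A *m Q^T).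
Proof. by move=> skA; rewrite !trmx_mul trmxK skA mulNmx mulmxN mulmxA. Qed.

(** A skew form is nondegenerate on every complement of its radical. *)
Lemma skew_nondeg_part n (X : 'M[K]_n) : X^T = - X ->
  exists C : 'M_(\rank X, n), C *m X *m C^T \in unitmx.
Proof.
move=> skX; have /submxP[C CX] : (row_base X <= X)%MS by rewrite eq_row_base.
exists C; have /submxP[Y defX] : (X <= C *m X)%MS by rewrite -CX eq_row_base.
have XY : X = X *m C^T *m Y^T.
  have := congr1 trmx defX; rewrite !trmx_mul skX mulNmx mulNmx.
  by move/oppr_inj.
rewrite -row_free_unit /row_free eqn_leq rank_leq_row /=.
have /eqP rCX : row_free (C *m X) by rewrite -CX row_base_free.
have CXY : C *m X = C *m X *m C^T *m Y^T by rewrite -!mulmxA (mulmxA X) -XY.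
by have := mxrankM_maxl (C *m X *m C^T) Y^T; rewrite -CXY rCX.
Qed.

(** The pencil may drop rank at infinity, by at most the rank R of A on a
    space of vectors Q killed by B. Let P span a subspace of that space on
    which A is nondegenerate. Subtracting from A the form T, which is A on P
    and zero on the orthogonal of P, adds P to the kernel of every finite
    member and leaves B alone: the new pencil has constant rank rho - R, and
    [regular_pencil_rank] applies to it. *)
Lemma pencil_sum_ker A B rho (S : seq K) n (Q : 'M_(n, m)) k (L : 'M_(k, m)) :
  A^T = - A -> B^T = - B -> (forall s, \rank (A + s *: B)%R = rho) ->
  (rho <= \rank B + \rank (Q *m A *m Q^T)%R)%N -> Q *m B = 0 ->
  uniq S -> 0 \notin S -> (m < size S)%N ->
  {in S, forall s, (kermx (A + s *: B) <= L)%MS} ->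
  (m + m <= 2 * \rank L + rho + \rank (Q *m A *m Q^T)%R)%N.
Proof.
move=> skA skB rP rB QB uS S0 sS SL; move: rB.
have skX : (Q *m A *m Q^T)^T = - (Q *m A *m Q^T).
  exact: skew_congr.
have [C] := skew_nondeg_part skX; move: (\rank _) C => R C uC rB.
have [P [PB uX]] : exists P : 'M_(R, m), P *m B = 0 /\ P *m A *m P^T \in unitmx.
  exists (C *m Q); rewrite -mulmxA QB mulmx0; split=> //.
  by move: uC; rewrite trmx_mul !mulmxA.
set X := P *m A *m P^T in uX.
have skXP : X^T = - X by apply: skew_congr.
have skJ : (invmx X)^T = - invmx X.
  apply: (can_inj (mulKmx uX)); rewrite mulmxN mulmxV // trmx_inv skXP.
  by rewrite -[X in X *m _]opprK mulNmx mulmxV // -skXP unitmx_tr.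
(* The projection to P along its orthogonal is w |-> w A P^T X^-1 P. *)
pose T := A *m P^T *m invmx X *m P *m A.
have skT : T^T = - T.
  by rewrite !trmx_mul trmxK skJ skA !(mulNmx, mulmxN) !opprK /T !mulmxA.
have rT : (\rank T <= R)%N.
  by rewrite /T -!mulmxA (mulmxA A) (mulmxA (A *m _)) (leq_trans (mxrankM_maxl _ _)) ?rank_leq_col.
have BP : B *m P^T = 0 by apply: skew_ker skB PB.
pose A' := A - T.
have skA' : A'^T = - A' by rewrite linearB /= skA skT opprB addrC opprK.
have PA' s : P *m (A' + s *: B) = 0.
  rewrite mulmxDr -scalemxAr PB scaler0 addr0 mulmxBr /T !mulmxA.
  by rewrite -/X mulmxV // mul1mx subrr.
have kP s : (kermx (A + s *: B) <= kermx (A' + s *: B))%MS.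
  apply/sub_kermxP; set k0 := kermx _.
  have k0A : k0 *m A = - (s *: (k0 *m B)).
    by apply/eqP; rewrite -addr_eq0 scalemxAr -mulmxDr mulmx_ker.
  rewrite mulmxDr mulmxBr -addrA (addrC (- _)) addrA -mulmxDr mulmx_ker add0r.
  by rewrite /T !mulmxA k0A !mulNmx -!scalemxAl -(mulmxA k0) BP mulmx0 !mul0mx scaler0 !oppr0.
have Pfree : row_free P.
  rewrite /row_free eqn_leq rank_leq_row /= -{1}(mxrank_unit uX) /X -mulmxA.
  exact: mxrankM_maxl.
have capP s : (P :&: kermx (A + s *: B)%R)%MS = 0.
  apply/eqP; rewrite -submx0; set I0 := (_ :&: _)%MS.
  have /submxP[D defI] : (I0 <= P)%MS by apply: capmxSl.
  have : I0 *m (A + s *: B) = 0 by apply/sub_kermxP; apply: capmxSr.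
  rewrite defI => /(congr1 (fun M => M *m P^T)).
  rewrite mul0mx mulmxDr mulmxDl -scalemxAr -scalemxAl -(mulmxA _ B) BP mulmx0 scaler0 addr0.
  rewrite -!mulmxA (mulmxA P) -/X => DX.
  by rewrite -(mulmxK uX D) DX !mul0mx sub0mx.
have rP' s : \rank (A' + s *: B)%R = (rho - R)%N.
  have le1 : (\rank P + \rank (kermx (A + s *: B)%R) <= \rank (kermx (A' + s *: B)%R))%N.
    rewrite -mxrank_sum_cap capP mxrank0 addn0 mxrankS // addsmx_sub kP andbT.
    by apply/sub_kermxP.
  have le2 : (\rank (A + s *: B)%R <= \rank (A' + s *: B)%R + \rank T)%N.
    have -> : A + s *: B = (A' + s *: B) + T by rewrite addrAC subrK.
    exact: mxrank_add.
  move: le1 le2; rewrite !mxrank_ker (eqP Pfree) rP.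
  have := rank_leq_row (A' + s *: B); have := rank_leq_row (A + s *: B); rewrite rP.
  by move: rT; clear; lia.
have rB' : \rank B = (rho - R)%N.
  have : (\rank (B + 0 *: A')%R <= rho - R)%N.
    apply: (pencil_rank_le charK (T := [:: 0])) => s; rewrite inE => nz.
    have -> : B + s *: A' = s *: (A' + s^-1 *: B).
      by rewrite [RHS]scalerDr scalerA mulfV // scale1r addrC.
    by rewrite (leq_trans (mxrank_scale _ _)) // rP'.
  by rewrite scale0r addr0; move: rB; clear; lia.
have := regular_pencil_rank charK skA' skB rP' rB' uS S0 sS.
set L' := (\sum_(s <- S) _)%MS => hL'.
have sL' : (L' <= L + P)%MS.
  apply: seq_sumsmx_sub => s sinS.
  have sub1 : (kermx (A + s *: B) + P <= kermx (A' + s *: B))%MS.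
    by rewrite addsmx_sub kP; apply/sub_kermxP.
  apply: submx_trans (_ : (kermx (A + s *: B) + P <= _)%MS); last first.
    by rewrite addsmxS ?SL.
  rewrite -(geq_leqif (mxrank_leqif_sup sub1)).
  have := mxrank_sum_cap (kermx (A + s *: B)) P; rewrite capmxC capP mxrank0 addn0 => ->.
  rewrite !mxrank_ker (eqP Pfree) rP rP'.
  by have := rank_leq_row (A + s *: B); rewrite rP; clear; lia.
have := leq_trans (mxrankS sL') (mxrank_adds_leqif L P); rewrite (eqP Pfree).
have rho_m : (rho <= m)%N by rewrite -(rP 0) rank_leq_row.
have Rrho : (R <= rho)%N.
  rewrite -(rP 0) -{1}(mxrank_unit uX) scale0r addr0 /X.
  by rewrite (leq_trans (mxrankM_maxl _ _)) ?mxrankM_maxr.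
by move: hL' rho_m Rrho; clear; lia.
Qed.

(** On the sum E of L and the span of Q the form A has no more rank than on
    Q, because L is in the radical; and a subspace of large dimension
    supports a form of large rank, by the Frobenius inequality. *)
Lemma isotropic_rank_le A n (Q : 'M_(n, m)) k (L : 'M_(k, m)) :
  A^T = - A -> L *m A *m L^T = 0 -> L *m A *m Q^T = 0 ->
  (2 * \rank L + \rank A + \rank (Q *m A *m Q^T)%R <= m + m)%N.
Proof.
move=> skA LL LQ; set X := Q *m A *m Q^T.
pose E := col_mx L Q.
have EQ : \rank (E *m (A *m Q^T))%R = \rank X.
  by rewrite mul_col_mx !mulmxA LQ rank_col_0mx.
have LE : (L <= E :&: kermx (A *m Q^T))%MS.
  rewrite sub_capmx -(addsmxE L Q) addsmxSl /=.
  by apply/sub_kermxP; rewrite mulmxA.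
have rE : (\rank X + \rank L <= \rank E)%N.
  by rewrite -(mxrank_mul_ker E (A *m Q^T)) EQ leq_add2l mxrankS.
have QL : Q *m A *m L^T = 0.
  by apply: trmx_inj; rewrite !trmx_mul trmxK skA mulNmx mulmxN mulmxA LQ oppr0 trmx0.
have EAE : \rank (E *m A *m E^T)%R = \rank X.
  rewrite !mul_col_mx tr_col_mx !mul_mx_row LL LQ QL row_mx0.
  by rewrite rank_col_0mx rank_row_0mx.
have := mxrank_Frobenius E A E^T; rewrite EAE.
have <- : \rank (E *m A)%R = \rank (A *m E^T)%R.
  by rewrite -mxrank_tr trmx_mul skA mulNmx mxrank_opp.
have := mxrank_mul_min E A.
move: rE; clear; move: (\rank X) (\rank L) (\rank E) (\rank A) (\rank (E *m A)%R) => a b c d e; lia.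
Qed.
End Reduction.

(** * Polynomials in several variables over an infinite field *)

Section MPoly.
Variables (K : fieldType) (charK : [pchar K] =i pred0).

Let wid n (i : 'I_n) : 'I_n.+1 := widen_ord (leqnSn n) i.

Lemma mcoeff_muni n (f : {mpoly K[n.+1]}) (m : 'X_{1..n.+1}) :
  ((muni f)`_(m ord_max))@_[multinom m (wid i) | i < n] = f@_m.
Proof.
rewrite muniE coef_sum raddf_sum /= [in RHS](mpolyE f) raddf_sum /=.
apply: eq_bigr => m' _; rewrite mcoeffZ mcoeffX coefZ coefXn.
rewrite -[_ *: 'X_[_]]/(f@_m' *: _).
case: (eqVneq m' m) => [->|ne].
  by rewrite eqxx mulr1 mcoeffZ mcoeffX eqxx.
rewrite mulr0; case: eqP => [e|]; last by rewrite mulr0 mcoeff0.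
rewrite mulr1 mcoeffZ mcoeffX; case: eqP => [/mnmP e'|]; last by rewrite mulr0.
case/eqP: ne; apply/mnmP => i.
case: (unliftP ord_max i) => [j|] ->; last by rewrite e.
have -> : lift ord_max j = wid j by apply: val_inj; rewrite /= /bump leqNgt ltn_ord.
by have := e' j; rewrite !mnmE.
Qed.

Lemma meval_muni n (f : {mpoly K[n.+1]}) (x : 'I_n.+1 -> K) :
  f.@[x] = (map_poly (meval (x \o @wid n)) (muni f)).[x ord_max].
Proof.
rewrite muniE rmorph_sum horner_sum mevalE; apply: eq_bigr => m _ /=.
rewrite map_polyZ /= map_polyXn hornerZ hornerXn mevalZ mevalX big_ord_recr /=.
by rewrite mulrA; congr (_ * _ * _); apply: eq_bigr => i _; rewrite mnmE.
Qed.

Lemma mpoly_eq0_meval n (f : {mpoly K[n]}) : (forall x, f.@[x] = 0) -> f = 0.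
Proof.
elim: n f => [|n IH] f f0.
  by have := f0 (fun=> 0); rewrite (nvar0_mpolyC f) mevalC => ->; rewrite mpolyC0.
apply/mpolyP => m; rewrite mcoeff0 -mcoeff_muni (IH (muni f)`_(m ord_max)) ?mcoeff0 //.
move=> x; rewrite -coef_map [map_poly _ _](@poly_eq0_cofinite _ charK _ [::]) ?coef0 // => c _.
pose y (i : 'I_n.+1) := if unlift ord_max i is Some j then x j else c.
rewrite -[RHS](f0 y) meval_muni /y unlift_none; congr (_.[_]).
apply: eq_map_poly => g; apply: meval_eq => i /=.
have -> : wid i = lift ord_max i by apply: val_inj; rewrite /= /bump leqNgt ltn_ord.
by rewrite liftK.
Qed.

Lemma mpoly_nonroot n (f : {mpoly K[n]}) : f != 0 -> exists x, f.@[x] != 0.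
Proof.
move=> nz; apply: contrapT => h; case/eqP: nz; apply: mpoly_eq0_meval => x.
by apply: contrapT => /eqP fx; apply: h; exists x.
Qed.

Lemma mderiv_comp_mpoly n k (F : k.-tuple {mpoly K[n]}) (P : {mpoly K[k]}) j :
  (P \mPo F)^`M(j) = \sum_i (P^`M(i) \mPo F) * (tnth F i)^`M(j).
Proof.
pose D P := \sum_i (P^`M(i) \mPo F) * (tnth F i)^`M(j).
have D1 : D 1 = 0.
  by rewrite /D big1 // => i _; rewrite -mpolyC1 mderivC comp_mpoly0 mul0r.
have DM P1 P2 : D (P1 * P2) = D P1 * (P2 \mPo F) + (P1 \mPo F) * D P2.
  rewrite /D mulr_suml mulr_sumr -big_split; apply: eq_bigr => i _ /=.
  by rewrite mderivM comp_mpolyD !rmorphM /= mulrDl mulrAC !mulrA.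
have DX i : D 'X_i = (tnth F i)^`M(j).
  rewrite /D (bigD1 i) //= mderivX mnm1E eqxx scale1r -{1}[U_(i)%MM]add0m addmK.
  rewrite mpolyX0 comp_mpoly1 mul1r.
  rewrite big1 ?addr0 // => i' ne; rewrite mderivX mnm1E eq_sym (negPf ne) scale0r.
  by rewrite comp_mpoly0 mul0r.
have DZD c P1 P2 : D (c *: P1 + P2) = c *: D P1 + D P2.
  rewrite /D scaler_sumr -big_split; apply: eq_bigr => i _ /=.
  by rewrite mderivD mderivZ comp_mpolyD comp_mpolyZ mulrDl scalerAl.
pose ok Q := (Q \mPo F)^`M(j) = D Q.
have ok1 : ok 1 by rewrite /ok D1 comp_mpoly1 -mpolyC1 mderivC.
have okM Q1 Q2 : ok Q1 -> ok Q2 -> ok (Q1 * Q2).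
  by rewrite /ok => h1 h2; rewrite DM rmorphM /= mderivM h1 h2.
rewrite -/(D P) -/(ok P); elim/mpolyind: P => [|c m P _ _ okP].
  by rewrite /ok comp_mpoly0 mderiv0 /D big1 // => i _; rewrite mderiv0 comp_mpoly0 mul0r.
rewrite /ok DZD comp_mpolyD comp_mpolyZ mderivD mderivZ okP; congr (_ *: _ + _).
rewrite -/(ok _) mpolyXE_id; apply: big_ind => // i _; elim: (m i) => [|e IHe]; rewrite ?expr0 // exprS.
by apply: okM => //; rewrite /ok DX comp_mpolyXU -tnth_nth.
Qed.

Lemma msize_mderiv n (P : {mpoly K[n]}) i :
  P^`M(i) != 0 -> (msize P^`M(i) < msize P)%N.
Proof.
move=> nz; rewrite -(mlead_deg nz).
have : P@_(mlead P^`M(i) + U_(i)) != 0.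
  apply: contraNneq nz => h; rewrite -mleadc_eq0 mcoeff_mderiv h mul0rn.
  by rewrite eqxx.
rewrite -mcoeff_msupp => /msize_mdeg_lt.
by rewrite mdegD mdeg1 addn1.
Qed.

(** This is where characteristic 0 enters the theory of derivatives. *)
Lemma mderiv0_supp n (P : {mpoly K[n]}) i m : P^`M(i) = 0 -> m \in msupp P -> m i = 0%N.
Proof.
rewrite mcoeff_msupp => h; apply: contraNeq => mi.
have := mcoeff_mderiv i P (m - U_(i)).
rewrite h mcoeff0 submK; last first.
  by apply/mnm_lepP => j; rewrite mnm1E; case: eqP => // <-; rewrite lt0n.
by move/esym/eqP; rewrite -mulr_natr mulf_eq0 ((pcharf0P K).1 charK) orbF.
Qed.

Lemma mderiv_const n (P : {mpoly K[n]}) :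
  (forall i, P^`M(i) = 0) -> P = (P@_0)%:MP.
Proof.
move=> h; apply/mpolyP => m; rewrite mcoeffC.
case: (eqVneq 0%MM m) => [<-|]; rewrite ?mulr1 // mulr0 => ne.
apply: contraNeq ne; rewrite -mcoeff_msupp => Pm.
by apply/eqP/mnmP => i; rewrite mnm0E (mderiv0_supp (h i) Pm).
Qed.

End MPoly.

(** * Algebraic independence and differentials *)

Section Jacobian.
Variables (K : fieldType) (charK : [pchar K] =i pred0) (N : nat).
Implicit Types (f : {mpoly K[N]}) (x : 'I_N -> K) (L : seq {mpoly K[N]}).

Definition grad f x : 'rV[K]_N := \row_j f^`M(j).@[x].
Definition jac k (F : k.-tuple {mpoly K[N]}) x : 'M[K]_(k, N) :=
  \matrix_i grad (tnth F i) x.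

Lemma gradE f x j : grad f x 0 j = f^`M(j).@[x].
Proof. by rewrite mxE. Qed.

(** A rank condition from below is open: it is witnessed by a minor. *)
Lemma rank_open a b (M : 'M[{mpoly K[N]}]_(a, b)) x0 r :
  (r <= \rank (map_mx (meval x0) M))%N ->
  exists2 J : {mpoly K[N]}, J.@[x0] != 0 &
    forall x, J.@[x] != 0 -> (r <= \rank (map_mx (meval x) M))%N.
Proof.
move=> /rank_unit_minor[C [D CD]].
pose cst a b (X : 'M[K]_(a, b)) : 'M[{mpoly K[N]}]_(a, b) := map_mx (@mpolyC N K) X.
pose J := \det (cst _ _ C *m M *m cst _ _ D).
have JE x : J.@[x] = \det (C *m map_mx (meval x) M *m D).
  rewrite /J -det_map_mx !map_mxM /=; congr (\det (_ *m _ *m _));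
    by apply/matrixP => i j; rewrite !mxE mevalC.
exists J => [|x]; first by rewrite JE CD det1 oner_neq0.
by rewrite JE => nz; apply: (@unit_minor_rank _ _ _ _ _ C D); rewrite unitmxE unitfE.
Qed.

Lemma rel_ev k (F : k.-tuple {mpoly K[N]}) (P : {mpoly K[k]}) :
  P \mPo F = 0 <-> forall x, P.@[fun i => (tnth F i).@[x]] = 0.
Proof.
split=> [h x|h]; first by rewrite -comp_mpoly_meval h meval0.
by apply: (mpoly_eq0_meval charK) => x; rewrite comp_mpoly_meval.
Qed.

(** A relation of least degree is useful because none of its nonzero
    derivatives is a relation, see [minimal_relation_mderiv]. *)
Lemma minimal_relation k (F : k.-tuple {mpoly K[N]}) : ~ alg_indep F ->
  exists P : {mpoly K[k]}, [/\ P != 0, P \mPo F = 0 &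
    forall Q, Q \mPo F = 0 -> (msize Q < msize P)%N -> Q = 0].
Proof.
move=> dep; pose bad s := `[< exists P : {mpoly K[k]}, [/\ P != 0, P \mPo F = 0 & msize P = s] >].
have : exists s, bad s.
  apply: contrapT => h; apply: dep => P P0; case: (eqVneq P 0) => // nz.
  by case: h; exists (msize P); apply/asboolP; exists P.
move=> exs; case: (ex_minnP exs) => s /asboolP[P [nz P0 sP]] mins.
exists P; split=> // Q Q0; rewrite sP ltnNge => /negP h; case: (eqVneq Q 0) => // nzQ.
by case: h; apply: mins; apply/asboolP; exists Q.
Qed.

Lemma minimal_relation_mderiv k (F : k.-tuple {mpoly K[N]}) (P : {mpoly K[k]}) :
  (forall Q, Q \mPo F = 0 -> (msize Q < msize P)%N -> Q = 0) ->
  forall i, P^`M(i) \mPo F = 0 -> P^`M(i) = 0.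
Proof.
move=> minP i h; case: (eqVneq P^`M(i) 0) => // nz.
by apply: minP => //; apply: msize_mderiv.
Qed.

Lemma mderiv_rel k (F : k.-tuple {mpoly K[N]}) (P : {mpoly K[k]}) x :
  P \mPo F = 0 -> \sum_i (P^`M(i) \mPo F).@[x] *: grad (tnth F i) x = 0.
Proof.
move=> P0; apply/rowP => j; rewrite summxE [RHS]mxE.
have := mderiv_comp_mpoly F P j; rewrite P0 mderiv0 => /(congr1 (meval x)).
rewrite raddf0 raddf_sum /= => h; rewrite [RHS]h; apply: eq_bigr => i _.
by rewrite mxE gradE mevalM.
Qed.

(** If the differentials are independent at one point, some square matrix of
    polynomials extracted from them has a nonzero determinant. Differentiating
    a minimal relation P then shows that all the derivatives of P are
    relations, so they vanish and P is constant. *)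
Lemma jac_alg_indep k (F : k.-tuple {mpoly K[N]}) x :
  row_free (jac F x) -> alg_indep F.
Proof.
move=> /row_freeP[C JC]; apply: contrapT => /minimal_relation[P [nz P0 minP]].
pose M : 'M[{mpoly K[N]}]_(k, N) := \matrix_(i, j) (tnth F i)^`M(j).
pose E := M *m map_mx (@mpolyC N K) C.
have Ex : map_mx (meval x) E = 1%:M.
  rewrite map_mxM /= -JC; congr (_ *m _); apply/matrixP => i j; rewrite !mxE //.
  by rewrite mevalC.
pose c : 'rV_k := \row_i (P^`M(i) \mPo F).
have cM : c *m M = 0.
  apply/rowP => j; have := mderiv_comp_mpoly F P j; rewrite P0 mderiv0 => h.
  rewrite mxE [RHS]mxE [RHS]h.
  by apply: eq_bigr => i _; rewrite !mxE.
have detE : \det E != 0.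
  by apply/eqP => /(congr1 (meval x)); rewrite -det_map_mx Ex det1 meval0 => /eqP; rewrite oner_eq0.
have c0 : c = 0.
  have : c *m E *m \adj E = 0 by rewrite mulmxA cM !mul0mx.
  rewrite -mulmxA mul_mx_adj mul_mx_scalar => /eqP.
  by rewrite scalemx_eq0 (negPf detE) /= => /eqP.
have dP i : P^`M(i) = 0.
  apply: (minimal_relation_mderiv minP); have := congr1 (fun v : 'rV_k => v 0 i) c0.
  by rewrite !mxE.
have PC := mderiv_const charK dP; move: P0; rewrite PC comp_mpolyC => /eqP.
by rewrite mpolyC_eq0 => P0; rewrite PC mpolyC_eq0 P0 in nz.
Qed.

(** In characteristic 0 a vanishing derivative means that the variable does
    not occur. *)
Lemma meval_mderiv0 n (P : {mpoly K[n]}) i (y y' : 'I_n -> K) : P^`M(i) = 0 ->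
  (forall j, j != i -> y j = y' j) -> P.@[y] = P.@[y'].
Proof.
move=> h yy'; rewrite !mevalE; apply: eq_big_seq => m /(mderiv0_supp charK h) mi.
congr (_ * _); apply: eq_bigr => j _.
by case: (eqVneq j i) => [->|/yy'->]; rewrite ?mi ?expr0.
Qed.

Definition indep_seq L := alg_indep (in_tuple L).
Definition jac_seq L x := jac (in_tuple L) x.

(** A minimal relation between f and the elements of L must involve f, for L
    is independent. Its derivative D along f does not vanish, and where D is
    nonzero the differential of the relation expresses that of f by those of
    L. *)
Lemma exchange L f : indep_seq L -> ~ indep_seq (rcons L f) ->
  exists2 D : {mpoly K[N]}, D != 0 &
    forall x, D.@[x] != 0 -> (grad f x <= jac_seq L x)%MS.
Proof.
move=> indL /minimal_relation[P [nz P0 minP]].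
have szL : (size L < size (rcons L f))%N by rewrite size_rcons.
pose l : 'I_(size (rcons L f)) := Ordinal szL.
have tl : tnth (in_tuple (rcons L f)) l = f.
  by rewrite (tnth_nth 0) /= nth_rcons ltnn eqxx.
have tlt (i : 'I_(size (rcons L f))) : i != l -> exists2 j : 'I_(size L), val j = val i &
    tnth (in_tuple (rcons L f)) i = tnth (in_tuple L) j.
  move=> ne; have lt_i : (i < size L)%N.
    by have := ltn_ord i; rewrite {2}size_rcons ltnS leq_eqVlt => /orP[/eqP e|//]; case/eqP: ne; apply: val_inj.
  by exists (Ordinal lt_i) => //; rewrite !(tnth_nth 0) /= nth_rcons lt_i.
exists (P^`M(l) \mPo (in_tuple (rcons L f))).
  apply/eqP => /(minimal_relation_mderiv minP) dP.
  (* Substitution that drops the last variable, which does not occur in P. *)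
  pose T0 : (size (rcons L f)).-tuple {mpoly K[size L]} :=
    [tuple oapp (fun j : 'I_(size L) => 'X_j) 0 (insub (val i)) | i < size (rcons L f)].
  have T0E (y : 'I_(size L) -> K) i : (tnth T0 i).@[y] = oapp y 0 (insub (val i)).
    rewrite tnth_mktuple; case: insubP => [j _ _|_] /=; first by rewrite mevalXU.
    by rewrite meval0.
  case/eqP: nz; apply: (mpoly_eq0_meval charK) => y.
  have Q0 : P \mPo T0 = 0.
    apply: indL; apply/rel_ev => x; rewrite comp_mpoly_meval.
    rewrite -[RHS](proj1 (rel_ev _ _) P0 x); apply: (meval_mderiv0 dP) => i ne.
    rewrite T0E; have [j ji ->] := tlt i ne.
    by rewrite -ji; case: insubP => [u _ /val_inj -> //|]; rewrite ltn_ord.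
  pose y' (j : 'I_(size L)) := y (widen_ord (ltnW szL) j).
  transitivity ((P \mPo T0).@[y']); last by rewrite Q0 meval0.
  rewrite comp_mpoly_meval; apply: (meval_mderiv0 dP) => i ne.
  rewrite T0E; have [j ji _] := tlt i ne; rewrite -ji.
  case: insubP => [u _ /val_inj -> /=|]; last by rewrite ltn_ord.
  by congr y; apply: val_inj; rewrite /= ji.
move=> x nzx; have := mderiv_rel x P0; rewrite (bigD1 l) //= tl => /eqP.
rewrite addr_eq0 => /eqP h.
rewrite -(scale1r (grad f x)) -(mulVf nzx) -scalerA h.
apply: scalemx_sub; rewrite -scaleN1r; apply: scalemx_sub; apply: summx_sub => i ne.
apply: scalemx_sub; have [j _ ->] := tlt i ne.
by rewrite -(rowK (fun j => grad (tnth (in_tuple L) j) x)) row_sub.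
Qed.

End Jacobian.


Section Counting.
Variables (K : fieldType) (N : nat).

Lemma msizeM_bound (p q : {mpoly K[N]}) a b :
  (msize p <= a.+1)%N -> (msize q <= b.+1)%N -> (msize (p * q) <= (a + b).+1)%N.
Proof.
move=> pa qb; case: (eqVneq p 0) => [->|nzp]; first by rewrite mul0r msize0.
case: (eqVneq q 0) => [->|nzq]; first by rewrite mulr0 msize0.
by rewrite msizeM //; move: pa qb; move: (msize p) (msize q) => x y; lia.
Qed.

Lemma msize_prod_bound k (F : 'I_k -> {mpoly K[N]}) (D : nat) (e : 'I_k -> nat) :
  (forall i, msize (F i) <= D.+1)%N ->
  (msize (\prod_i F i ^+ e i)%R <= (\sum_i e i * D).+1)%N.
Proof.
move=> FD; apply: (big_ind2 (fun p a => msize p <= a.+1)%N).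
- by rewrite msize1.
- by move=> p a q b; apply: msizeM_bound.
- move=> i _; elim: (e i) => [|j IH]; first by rewrite expr0 msize1.
  by rewrite exprS mulSn; apply: msizeM_bound.
Qed.

(** Counting: if k > N, the d^k monomials of degree less than d in each of
    the k elements lie in a space of polynomials of dimension O(d^N), so some
    combination of them vanishes. *)
Lemma alg_indep_leq k (F : k.-tuple {mpoly K[N]}) : alg_indep F -> (k <= N)%N.
Proof.
move=> indF; rewrite leqNgt; apply/negP => lt_Nk.
pose D := \max_i msize (tnth F i).
have FD i : (msize (tnth F i) <= D.+1)%N.
  by apply: leqW; rewrite /D (leq_bigmax i).
(* [M] bounds the degrees of the monomials below, and [d] is so large that
   M ^ N < d ^ N.+1. *)
pose d := ((k * D).+1 ^ N).+1.
pose M := (k * d * D).+1.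
pose E := {ffun 'I_k -> 'I_d}; pose B := {ffun 'I_N -> 'I_M}.
pose mono n b (e : {ffun 'I_n -> 'I_b}) := [multinom (e i : nat) | i < n].
have mono_inj n b : injective (@mono n b).
  by move=> e e' /mnmP h; apply/ffunP => i; apply: val_inj; have := h i; rewrite !mnmE.
pose FE (e : E) := 'X_[K, mono _ _ e] \mPo F.
pose A : 'M[K]_(#|E|, #|B|) :=
  \matrix_(a, b) (FE (enum_val a))@_(mono _ _ (enum_val b)).
have ltBE : (#|B| < #|E|)%N.
  rewrite !card_ffun !card_ord.
  have leM : (M <= (k * D).+1 * d)%N by rewrite /M mulSn mulnAC addnC -addn1 leq_add2l.
  have leMN : (M ^ N <= ((k * D).+1 * d) ^ N)%N.
    by case: (posnP N) => [-> // | N_gt0]; rewrite leq_exp2r.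
  apply: leq_ltn_trans leMN _; rewrite expnMn.
  apply: leq_trans (_ : d ^ N.+1 <= _)%N; last by rewrite leq_pexp2l.
  by rewrite expnS ltn_pmul2r ?expn_gt0.
have : kermx A != 0.
  rewrite kermx_eq0 /row_free; apply/negP => /eqP rA.
  by have := rank_leq_col A; rewrite rA leqNgt ltBE.
case/rowV0Pn => c /sub_kermxP cA nzc.
pose P := \sum_(a < #|E|) c 0 a *: 'X_[K, mono _ _ (enum_val a)].
have P_neq0 : P != 0.
  apply: contra nzc => /eqP P0; apply/eqP/rowP => a; rewrite mxE.
  have := congr1 (mcoeff (mono _ _ (enum_val a))) P0.
  rewrite mcoeff0 raddf_sum (bigD1 a) //= mcoeffZ mcoeffX eqxx mulr1.
  rewrite big1 ?addr0 // => b ne; rewrite mcoeffZ mcoeffX.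
  by rewrite (inj_eq (@mono_inj _ _)) (inj_eq enum_val_inj) (negPf ne) mulr0.
case/eqP: P_neq0; apply: indF; apply/mpolyP => m; rewrite mcoeff0.
have -> : P \mPo F = \sum_(a < #|E|) ((c 0 a *: 'X_[K, mono _ _ (enum_val a)]) \mPo F).
  by rewrite /P (big_morph _ (comp_mpolyD F) (comp_mpoly0 F)).
rewrite raddf_sum /=.
under eq_bigr do rewrite comp_mpolyZ mcoeffZ.
case: (boolP [forall i, m i < M]%N) => [/forallP mM | ].
  pose b : B := [ffun i => Ordinal (mM i)].
  have := congr1 (fun v : 'rV_(#|B|) => v 0 (enum_rank b)) cA; rewrite !mxE.
  rewrite (_ : m = mono _ _ b); last by apply/mnmP => i; rewrite mnmE ffunE.
  by move=> h; rewrite -[RHS]h; apply: eq_bigr => a _; rewrite mxE enum_rankK.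
rewrite negb_forall => /existsP[i]; rewrite -leqNgt => Mm.
rewrite big1 // => a _; rewrite (memN_msupp_eq0 (msize_mdeg_ge _)) ?mulr0 //.
rewrite comp_mpolyX; apply: leq_trans (msize_prod_bound _ FD) _.
apply: (@leq_trans M); last first.
  by apply: leq_trans Mm _; rewrite mdegE (bigD1 i) //= leq_addr.
rewrite ltnS -mulnA -[k in (k * _)%N]card_ord -sum_nat_const.
by apply: leq_sum => j _; rewrite leq_mul2r mnmE ltnW ?orbT.
Qed.
End Counting.

Section AlgIndepJacobian.
Variables (K : fieldType) (charK : [pchar K] =i pred0) (N : nat).

Lemma alg_indep_tval k k' (F : k.-tuple {mpoly K[N]}) (G : k'.-tuple {mpoly K[N]}) :
  tval F = tval G -> alg_indep F -> alg_indep G.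
Proof.
move=> e; have ek : k = k' by rewrite -(size_tuple F) -(size_tuple G) e.
by case: k' / ek G e => G /val_inj ->.
Qed.

(** Enlarge L by variables to a maximal independent family G. By [exchange]
    the differentials of all variables, which span the whole space, are
    generically combinations of those of G; since G has at most N elements by
    [alg_indep_leq], the differentials of G are then independent. *)
Lemma indep_seq_jac (L : seq {mpoly K[N]}) : indep_seq L ->
  exists2 D : {mpoly K[N]}, D != 0 & forall x, D.@[x] != 0 -> row_free (jac_seq L x).
Proof.
move=> indL.
pose ext n := `[< exists s : seq 'I_N, size s = n /\ indep_seq (L ++ [seq 'X_j | j <- s]) >].
have ext0 : ext 0%N by apply/asboolP; exists [::]; rewrite cats0.
have extN n : ext n -> (n <= N)%N.
  move=> /asboolP[s [<- /alg_indep_leq]]; rewrite size_cat size_map.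
  by apply: leq_trans; rewrite leq_addl.
case: (ex_maxnP (ex_intro ext _ ext0) extN) => n /asboolP[s [ss inds]] maxn.
set G := L ++ _ in inds.
have dep i : ~ indep_seq (rcons G 'X_i).
  move=> ind; have : ext n.+1.
    apply/asboolP; exists (rcons s i); rewrite size_rcons ss; split=> //.
    by rewrite map_rcons -rcons_cat.
  by move/maxn; rewrite ltnn.
have ex i : exists D : {mpoly K[N]}, D != 0 /\
    forall x, D.@[x] != 0 -> (grad 'X_i x <= jac_seq G x)%MS.
  by have [D nz h] := exchange charK inds (dep i); exists D.
have [D hD] := choice ex.
exists (\prod_i D i); first by apply/prodf_neq0 => i _; have [] := hD i.
move=> x nz; have Dx i : (D i).@[x] != 0.
  by move: nz; rewrite rmorph_prod /= => /prodf_neq0; apply.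
have full : row_full (jac_seq G x).
  rewrite -sub1mx; apply/row_subP => i.
  have <- : grad 'X_i x = row i 1%:M.
    apply/rowP => j; rewrite gradE mderivX !mxE mnm1E.
    case: eqP => [->|_]; last by rewrite scale0r meval0.
    by rewrite scale1r -{1}[U_(j)%MM]add0m addmK mpolyX0 meval1.
  by have [_] := hD i; apply.
have Gfree : row_free (jac_seq G x).
  rewrite /row_free eqn_leq rank_leq_row /=; move: full; rewrite /row_full => /eqP ->.
  exact: alg_indep_leq inds.
apply: row_free_of_ker => c c0.
have szLG : (size L <= size G)%N by rewrite size_cat leq_addr.
pose w (i : 'I_(size L)) : 'I_(size G) := widen_ord szLG i.
have w_inj : injective w by move=> a b /(congr1 val) /= /val_inj.
pose E : 'M[K]_(size L, size G) := \matrix_(i, a) (w i == a)%:R.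
have cE i : (c *m E) 0 (w i) = c 0 i.
  rewrite mxE (bigD1 i) //= mxE eqxx mulr1 big1 ?addr0 // => j ne.
  by rewrite mxE (inj_eq w_inj) (negPf ne) mulr0.
have LE : jac_seq L x = E *m jac_seq G x.
  apply/row_matrixP => i; rewrite row_mul rowK.
  have -> : row i E = delta_mx 0 (w i).
    by apply/rowP => a; rewrite !mxE eqxx eq_sym.
  by rewrite -rowE rowK !(tnth_nth 0) /= nth_cat ltn_ord.
have cE0 : c *m E = 0 by apply: (row_free_eq0 Gfree); rewrite -mulmxA -LE.
by apply/rowP => i; rewrite -cE cE0 !mxE.
Qed.

Lemma alg_indep_jac k (F : k.-tuple {mpoly K[N]}) : alg_indep F ->
  exists2 D : {mpoly K[N]}, D != 0 & forall x, D.@[x] != 0 -> row_free (jac F x).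
Proof.
move=> indF; have indL : indep_seq (tval F) by apply: alg_indep_tval indF.
have [D nzD h] := indep_seq_jac indL; exists D => // x /h.
have : tval F = tval (in_tuple (tval F)) by [].
rewrite /jac_seq; move: (in_tuple _); rewrite size_tuple => G.
by move/val_inj=> <-.
Qed.
End AlgIndepJacobian.

(** * Lie-Poisson forms in coordinates *)

Section Coordinates.
Variables (K : fieldType) (V : vectType K).
Local Notation m := (\dim {:V}).
Local Notation e := (@basis_vec K V).
Implicit Types (x : 'I_m -> K) (v w : V).

Definition coord_row v : 'rV[K]_m := \row_i coord (vbasis {:V}) i v.
(** The points of the dual of V are given by their values x on the fixed
    basis; [form_at x] is the corresponding linear form. *)
Definition form_at x v : K := \sum_i x i * coord (vbasis {:V}) i v.

Lemma form_at_linear x : linear (form_at x : V -> K^o).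
Proof.
move=> a u v; rewrite /form_at scaler_sumr -big_split; apply: eq_bigr => i _ /=.
by rewrite linearD linearZ /= mulrDr mulrCA.
Qed.

HB.instance Definition _ x := GRing.isLinear.Build K V K^o *:%R (form_at x) (@form_at_linear x).

Lemma form_at_subZ x a u v : form_at x (u - a *: v) = form_at x u - a * form_at x v.
Proof. by rewrite linearB linearZ. Qed.

Lemma form_atZ x a v : form_at x (a *: v) = a * form_at x v.
Proof. exact: linearZ. Qed.

Lemma coord_row_linear : linear coord_row.
Proof. by move=> a u v; apply/rowP => i; rewrite !mxE linearD linearZ. Qed.

HB.instance Definition _ := GRing.isLinear.Build K V 'rV[K]_m *:%R coord_row coord_row_linear.

Lemma sum_coord v : v = \sum_i coord (vbasis {:V}) i v *: e i.
Proof. exact: coord_vbasis (memvf v). Qed.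

Lemma coord_row_inj v : coord_row v = 0 -> v = 0.
Proof.
move=> h; rewrite (sum_coord v) big1 // => i _.
by have /rowP/(_ i) := h; rewrite !mxE => ->; rewrite scale0r.
Qed.

Lemma coord_e i j : coord (vbasis {:V}) i (e j) = (i == j)%:R.
Proof. by rewrite coord_free ?(basis_free (vbasisP _)) // eq_sym. Qed.

Lemma form_at_e x i : form_at x (e i) = x i.
Proof.
rewrite /form_at (bigD1 i) //= coord_e eqxx mulr1 big1 ?addr0 // => j ne.
by rewrite coord_e (negPf ne) mulr0.
Qed.

Lemma coord_row_e i : coord_row (e i) = delta_mx 0 i.
Proof. by apply/rowP => j; rewrite !mxE coord_e. Qed.

Definition vec_of (c : 'rV[K]_m) : V := \sum_i c 0 i *: e i.

Lemma coord_row_vec_of c : coord_row (vec_of c) = c.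
Proof.
rewrite /vec_of linear_sum [RHS]row_sum_delta; apply: eq_bigr => i _.
by rewrite linearZ /= coord_row_e.
Qed.

Lemma form_at_sum x v : form_at x v = \sum_i coord (vbasis {:V}) i v * x i.
Proof. by apply: eq_bigr => i _; rewrite mulrC. Qed.

Lemma sym_incl_ev x v : (sym_incl v).@[x] = form_at x v.
Proof.
rewrite /sym_incl raddf_sum /form_at; apply: eq_bigr => i _ /=.
by rewrite mevalZ mevalXU mulrC.
Qed.

Lemma sym_incl_e i : sym_incl (e i) = 'X_i :> symalg V.
Proof.
rewrite /sym_incl (bigD1 i) //= coord_e eqxx scale1r big1 ?addr0 // => j ne.
by rewrite coord_e (negPf ne) scale0r.
Qed.

Definition skew_bilinear (br : V -> V -> V) : Prop :=
  [/\ forall y, linear (br^~ y), forall u, linear (br u) & forall u v, br u v = - br v u].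

Variable br : V -> V -> V.

(** The Lie-Poisson form at the point x of the dual space. *)
Definition gram x : 'M[K]_m := \matrix_(i, j) form_at x (br (e i) (e j)).
(** The Poisson tensor: the same matrix with linear functions of the point as
    entries. *)
Definition gram_poly : 'M[{mpoly K[m]}]_m := \matrix_(i, j) sym_incl (br (e i) (e j)).

Lemma gram_poly_ev x : map_mx (meval x) gram_poly = gram x.
Proof. by apply/matrixP => i j; rewrite !mxE sym_incl_ev. Qed.

Lemma poisson_ev (H F : symalg V) x :
  (poisson br H F).@[x] = (grad H x *m gram x *m (grad F x)^T) 0 0.
Proof.
rewrite /poisson raddf_sum mxE.
under [RHS]eq_bigr do rewrite mxE mulr_suml.
rewrite exchange_big /=; apply: eq_bigr => i _; rewrite raddf_sum; apply: eq_bigr => j _ /=.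
by rewrite !mevalM sym_incl_ev !mxE mulrAC.
Qed.

Lemma grad_e i x : grad ('X_i : symalg V) x = delta_mx 0 i.
Proof.
apply/rowP => j; rewrite gradE mderivX mxE mnm1E eqxx /= eq_sym.
case: eqP => [->|_]; last by rewrite scale0r meval0.
by rewrite scale1r -{1}[U_(i)%MM]add0m addmK mpolyX0 meval1.
Qed.

Lemma poisson_X_ev (H : symalg V) j x :
  (poisson br H 'X_j).@[x] = (grad H x *m gram x) 0 j.
Proof. by rewrite poisson_ev grad_e trmx_delta -colE mxE. Qed.

Lemma centre_grad (H : symalg V) : poisson_centre br H ->
  forall x, grad H x *m gram x = 0.
Proof. by move=> h x; apply/rowP => j; rewrite -poisson_X_ev h meval0 mxE. Qed.

Lemma grad_centre (H : symalg V) : [pchar K] =i pred0 ->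
  (forall x, grad H x *m gram x = 0) -> poisson_centre br H.
Proof.
move=> charK h F; apply: (mpoly_eq0_meval charK) => x.
by rewrite poisson_ev h mul0mx mxE.
Qed.

Lemma invariants_grad (H : symalg V) : sym_invariants br H ->
  forall x, grad H x *m gram x = 0.
Proof.
move=> h x; apply/rowP => j.
by rewrite -poisson_X_ev -sym_incl_e h meval0 mxE.
Qed.

Hypothesis skbr : skew_bilinear br.

Lemma gram_skew x : (gram x)^T = - gram x.
Proof. by case: skbr => _ _ sk; apply/matrixP => i j; rewrite !mxE sk linearN. Qed.

Lemma form_at_lin x (I : finType) (c : I -> K) (f : I -> V) :
  form_at x (\sum_i c i *: f i) = \sum_i c i * form_at x (f i).
Proof. by rewrite (linear_sum (form_at x)); apply: eq_bigr => i _; rewrite linearZ. Qed.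

Lemma br_suml (I : finType) (c : I -> K) (f : I -> V) w :
  br (\sum_i c i *: f i) w = \sum_i c i *: br (f i) w.
Proof.
case: skbr => ll _ _; pose L := GRing.isLinear.Build K V V *:%R (br^~ w) (ll w).
pose Lw := HB.pack_for {linear V -> V} (br^~ w) L.
rewrite -[LHS]/(Lw _) (linear_sum Lw); apply: eq_bigr => i _.
by rewrite (linearZ_LR Lw).
Qed.

Lemma br_sumr (I : finType) (c : I -> K) (f : I -> V) w :
  br w (\sum_i c i *: f i) = \sum_i c i *: br w (f i).
Proof.
case: skbr => _ _ sk; rewrite sk br_suml -sumrN; apply: eq_bigr => i _.
by rewrite [br w _]sk scalerN.
Qed.

Lemma br_scalel a u v : br (a *: u) v = a *: br u v.
Proof.
have := br_suml (fun _ : 'I_1 => a) (fun=> u) v.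
by rewrite !big_ord1.
Qed.

Lemma br_scaler a u v : br u (a *: v) = a *: br u v.
Proof.
have := br_sumr (fun _ : 'I_1 => a) (fun=> v) u.
by rewrite !big_ord1.
Qed.

Lemma gram_br x u v : (coord_row u *m gram x *m (coord_row v)^T) 0 0 = form_at x (br u v).
Proof.
rewrite {2}(sum_coord u) {2}(sum_coord v) br_suml form_at_lin mxE.
under eq_bigr do rewrite mxE mulr_suml.
rewrite exchange_big; apply: eq_bigr => i _ /=.
rewrite br_sumr form_at_lin mulr_sumr; apply: eq_bigr => j _.
by rewrite !mxE mulrAC mulrA.
Qed.

End Coordinates.


Section Stab.
Variables (K : fieldType) (V : vectType K) (br : V -> V -> V).
Hypothesis lie : is_lie_bracket br.
Local Notation m := (\dim {:V}).
Local Notation e := (@basis_vec K V).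

Lemma lie_skew_bilinear : skew_bilinear br.
Proof.
case: lie => ll lr alt _; split=> // u v; apply/eqP; rewrite -addr_eq0; apply/eqP.
have addl a b c : br (a + b) c = br a c + br b c.
  by have := ll c 1 a b; rewrite /= !scale1r.
have addr a b c : br a (b + c) = br a b + br a c.
  by have := lr a 1 b c; rewrite /= !scale1r.
by have := alt (u + v); rewrite addl !addr !alt add0r addr0.
Qed.
Let skbr := lie_skew_bilinear.

Lemma dual_form_at (g : dual V) v : form_at (fun i => g (e i)) v = g v.
Proof.
rewrite {2}(sum_coord v) linear_sum; apply: eq_bigr => i _.
by rewrite linearZ /= mulrC.
Qed.

Lemma point_dual (x : 'I_m -> K) : exists g : dual V, forall v, g v = form_at x v.
Proof. by exists (linfun (form_at x : V -> K^o)) => v; rewrite lfunE. Qed.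

Lemma gram_eq x y : x =1 y -> gram br x = gram br y.
Proof. by move=> /funext ->. Qed.

Lemma stab_gram (g : dual V) v :
  (v \in stab br g) = (coord_row v *m gram br (fun i => g (e i)) == 0).
Proof.
apply/stabP/eqP => // [h | h w].
  apply/rowP => j; have := gram_br skbr (fun i => g (e i)) v (e j).
  by rewrite dual_form_at h coord_row_e trmx_delta -colE !mxE.
by rewrite -dual_form_at -(gram_br skbr) h mul0mx mxE.
Qed.

Lemma dim_stab (g : dual V) :
  \dim (stab br g) = (m - \rank (gram br (fun i => g (e i))))%N.
Proof.
set G := gram _ _; set U := stab br g; rewrite -mxrank_ker.
apply/eqP; rewrite eqn_leq; apply/andP; split.
  pose X : 'M_(\dim U, m) := \matrix_i coord_row (vbasis U)`_i.
  have Xfree : row_free X.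
    apply: row_free_of_ker => c; rewrite mulmx_sum_row.
    under eq_bigr do rewrite rowK -linearZ.
    rewrite -linear_sum => /coord_row_inj h; apply/rowP => i; rewrite mxE.
    by move/freeP: (basis_free (vbasisP U)) => /(_ (c 0) h).
  rewrite -{1}(eqP Xfree); apply: mxrankS; apply/row_subP => i; rewrite rowK.
  by apply/sub_kermxP/eqP; rewrite -stab_gram vbasis_mem // mem_nth ?size_tuple.
pose R := row_base (kermx G).
pose X := [tuple vec_of (row i R) | i < \rank (kermx G)].
have Xfree : free X.
  apply/freeP => k /(congr1 (@coord_row K V)); rewrite linear0 linear_sum => h i.
  have : (\row_i k i) *m R = 0.
    rewrite mulmx_sum_row -[RHS]h; apply: eq_bigr => j _.
    by rewrite -tnth_nth tnth_mktuple linearZ /= coord_row_vec_of [(\row__ _) 0 j]mxE.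
  by move/(row_free_eq0 (row_base_free _))/rowP/(_ i); rewrite !mxE.
rewrite -{1}(size_tuple X) -(eqP Xfree); apply/dimvS/span_subvP => v /tnthP[i ->].
rewrite tnth_mktuple stab_gram coord_row_vec_of; apply/eqP/sub_kermxP.
by rewrite (submx_trans (row_sub _ _)) // eq_row_base.
Qed.

Lemma ind_rank_le (x : 'I_m -> K) : (\rank (gram br x) <= m - ind br)%N.
Proof.
have [g gE] := point_dual x.
have xE : gram br x = gram br (fun i => g (e i)).
  by apply: gram_eq => i; rewrite gE form_at_e.
rewrite /ind; case: ex_minnP => d _ /(_ (\dim (stab br g))) h.
have /h : `[< exists g0 : dual V, \dim (stab br g0) = \dim (stab br g) >] by apply/asboolP; exists g.
rewrite dim_stab -xE; have := rank_leq_row (gram br x).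
by move: (\rank _) => r; lia.
Qed.

Lemma ind_regular : exists x : 'I_m -> K, \rank (gram br x) = (m - ind br)%N.
Proof.
rewrite /ind; case: ex_minnP => d /asboolP[g <-] _.
exists (fun i => g (e i)); rewrite dim_stab.
by rewrite subKn // rank_leq_row.
Qed.

Lemma ind_leq : (ind br <= m)%N.
Proof.
rewrite /ind; case: ex_minnP => d /asboolP[g <-] _.
by rewrite dim_stab leq_subr.
Qed.

Lemma sing_rank (g : dual V) :
  sing br g <-> (\rank (gram br (fun i => g (e i))) < m - ind br)%N.
Proof.
rewrite /sing dim_stab; have := ind_leq; have := ind_rank_le (fun i => g (e i)).
by move: (\rank _) => r; lia.
Qed.

Hypothesis charK : [pchar K] =i pred0.

(** Choose linearly independent functions y_1, ..., y_(N-1) that vanish at v.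
    Having codimension at least 2, the singular set satisfies a nontrivial
    relation P(y) = 0. The value of P(y) does not change along a line of
    direction v, so the whole line through u is regular as soon as P(y) is
    nonzero at u. *)
Lemma regular_lines : codim_property br 2 -> forall v : 'I_m -> K,
  exists2 G : {mpoly K[m]}, G != 0 & forall u, G.@[u] != 0 ->
    forall c, \rank (gram br (fun i => u i + c * v i)) = (m - ind br)%N.
Proof.
move=> codim2 v; pose vc : 'cV[K]_m := \col_i v i.
have rv : (m.-1 <= \rank (kermx vc))%N.
  by rewrite mxrank_ker; have := rank_leq_col vc; move: (\rank _) => r; lia.
have [Y Yfree /sub_kermxP Yv] := row_free_sub rv.
have [D YD] := row_freeP Yfree.
pose F : m.-1.-tuple (symalg V) := [tuple \sum_j Y i j *: 'X_j | i < m.-1].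
have FE i u : (tnth F i).@[u] = \sum_j Y i j * u j.
  rewrite tnth_mktuple raddf_sum; apply: eq_bigr => j _.
  by rewrite /= mevalZ mevalXU.
have [P [nzP P0]] : exists P : {mpoly K[m.-1]}, P != 0 /\
    forall g, sing br g -> P.@[fun i => sym_eval (tnth F i) g] = 0.
  apply: contrapT => h; have : alg_indep_on (sing br) F.
    move=> P P0; case: (eqVneq P 0) => // nz.
    by case: h; exists P.
  by move/codim2; lia.
exists (P \mPo F).
  have [z] := mpoly_nonroot charK nzP; apply: contra => /eqP P1.
  have := congr1 (meval (fun j => \sum_i D j i * z i)) P1.
  rewrite meval0 comp_mpoly_meval => <-; apply/eqP/meval_eq => i; rewrite FE.
  transitivity (\sum_i' (Y *m D) i i' * z i').
    rewrite YD (bigD1 i) //= mxE eqxx mul1r big1 ?addr0 // => j ne.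
    by rewrite mxE eq_sym (negPf ne) mul0r.
  under eq_bigr do rewrite mxE mulr_suml.
  rewrite exchange_big; apply: eq_bigr => j _; rewrite mulr_sumr.
  by apply: eq_bigr => k _; rewrite mulrA.
move=> u nz c; apply/eqP; rewrite eqn_leq ind_rank_le leqNgt /=.
apply: contra nz => lt; have [g gE] := point_dual (fun i => u i + c * v i).
have ge : (fun i => g (e i)) = (fun i => u i + c * v i).
  by apply/funext => i; rewrite gE form_at_e.
have /P0 : sing br g by apply/sing_rank; rewrite ge.
rewrite comp_mpoly_meval => <-; apply/eqP/meval_eq => i.
rewrite /sym_eval ge !FE.
under [RHS]eq_bigr do rewrite mulrDr mulrCA.
rewrite big_split -mulr_sumr /= (_ : \sum_j Y i j * v j = 0) ?mulr0 ?addr0 //.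
have := congr1 (fun M : 'M_(_, _) => M i 0) Yv; rewrite !mxE => h; rewrite -[RHS]h.
by apply: eq_bigr => j _; rewrite mxE.
Qed.
End Stab.

(** * Currents and their brackets modulo a polynomial *)

(** A nontrivial relation between the rows fails at the column of an index of
    least height among those with a nonzero coefficient. *)
Lemma triangular_rank (K : fieldType) m (M : 'M[K]_m) (I : finType) (h : I -> nat)
    (w w' : I -> 'rV[K]_m) :
  (forall i j, (h j < h i)%N -> (w i *m M *m (w' j)^T) 0 0 = 0) ->
  (forall i j, h i = h j -> (w i *m M *m (w' j)^T) 0 0 = (i == j)%:R) ->
  (#|I| <= \rank M)%N.
Proof.
move=> low diag; pose X : 'M[K]_(#|I|, m) := \matrix_a w (enum_val a).
pose Y : 'M[K]_(#|I|, m) := \matrix_a w' (enum_val a).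
have XY a b : (X *m M *m Y^T) a b = (w (enum_val a) *m M *m (w' (enum_val b))^T) 0 0.
  rewrite [LHS]mxE [RHS]mxE; apply: eq_bigr => j _; congr (_ * _); last by rewrite !mxE.
  by rewrite [LHS]mxE [RHS]mxE; apply: eq_bigr => l _; rewrite !mxE.
suff free : row_free (X *m M *m Y^T).
  rewrite -(eqP free) (leq_trans (mxrankM_maxl _ _)) ?mxrankM_maxr //.
apply: row_free_of_ker => c c0; apply/rowP => a; rewrite mxE.
have [k hk] := ubnP (h (enum_val a)); elim: k => // k IH in a hk *.
have := congr1 (fun v : 'rV_(#|I|) => v 0 a) c0; rewrite !mxE (bigD1 a) //= XY diag // eqxx mulr1.
rewrite big1 ?addr0 // => b ne; rewrite XY.
case: (ltngtP (h (enum_val a)) (h (enum_val b))) => [lt|gt|eq].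
- by rewrite low ?mulr0.
- by rewrite IH ?mul0r //; apply: leq_trans gt _.
- by rewrite diag // (inj_eq enum_val_inj) (negPf ne) mulr0.
Qed.

Lemma monic_pencil (K : fieldType) n (p l : {poly K}) c : (2 <= n)%N ->
  p \is monic -> size p = n.+1 -> (size l <= 2)%N ->
  p + c *: l \is monic /\ size (p + c *: l) = n.+1.
Proof.
move=> n2 mp sp sl; have scl : (size (c *: l) < size p)%N.
  by rewrite sp (leq_ltn_trans (size_scale_leq _ _)) // (leq_ltn_trans sl).
by rewrite monicE lead_coefDl // size_polyDl // (monicP mp).
Qed.

Section Current.
Variables (K : fieldType) (q : vectType K) (br : q -> q -> q) (n : nat).
Hypothesis skbr : skew_bilinear br.
Local Notation W := (Wspace q n).
Local Notation e := (@basis_vec K q).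
Local Notation N := (\dim {:q}).
Implicit Types (p l f g : {poly K}).

(** The element y f(t) of W. *)
Definition tens (y : q) (f : {poly K}) : W := [ffun k : 'I_n => f`_k *: y].

Lemma tens_sum (w : W) : w = \sum_(j < n) tens (w j) 'X^j.
Proof.
apply/ffunP => k; rewrite sum_ffunE (bigD1 k) //= ffunE coefXn eqxx scale1r.
rewrite big1 ?addr0 // => j ne; rewrite ffunE coefXn.
by rewrite [_ == _ :> nat](inj_eq val_inj) eq_sym (negPf ne) scale0r.
Qed.

Lemma tensDl f y1 y2 a : tens (a *: y1 + y2) f = a *: tens y1 f + tens y2 f.
Proof. by apply/ffunP => k; rewrite !ffunE scalerDr !scalerA mulrC. Qed.

Lemma tensZr y f a : tens y (a *: f) = a *: tens y f.
Proof. by apply/ffunP => k; rewrite !ffunE coefZ scalerA. Qed.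

Lemma tens_linear f : linear (tens^~ f).
Proof. by move=> a u v; rewrite tensDl. Qed.

Lemma tens_suml (I : finType) (c : I -> K) (y : I -> q) f :
  tens (\sum_i c i *: y i) f = \sum_i c i *: tens (y i) f.
Proof.
pose T := HB.pack_for {linear q -> W} (tens^~ f)
  (GRing.isLinear.Build K q W *:%R _ (tens_linear f)).
rewrite -[LHS]/(T _) (linear_sum T); apply: eq_bigr => i _.
exact: (linearZ_LR T).
Qed.

(** Common form of the brackets on W: c s stands for the polynomial that
    replaces t^s. *)
Definition br_coef (c : nat -> {poly K}) (u v : W) : W :=
  [ffun k : 'I_n => \sum_(i < n) \sum_(j < n) (c (i + j)%N)`_k *: br (u i) (v j)].

Lemma br_coef_skew c : skew_bilinear (br_coef c).
Proof.
have [ll lr sk] := skbr.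
have skc u v : br_coef c u v = - br_coef c v u.
  apply/ffunP => k; rewrite !ffunE exchange_big -sumrN; apply: eq_bigr => i _ /=.
  by rewrite -sumrN; apply: eq_bigr => j _; rewrite addnC sk scalerN.
have lrc u : linear (br_coef c u).
  move=> a v w; apply/ffunP => k; rewrite !ffunE scaler_sumr -big_split.
  apply: eq_bigr => i _ /=; rewrite scaler_sumr -big_split; apply: eq_bigr => j _ /=.
  by rewrite !ffunE lr scalerDr !scalerA mulrC.
split=> // v a u w.
by rewrite /= skc lrc opprD [br_coef c u v]skc [br_coef c w v]skc scalerN.
Qed.

Lemma br_coef_tens (T : {linear {poly K} -> {poly K}}) y y' (f f' : {poly K}) :
  (size f <= n)%N -> (size f' <= n)%N ->
  br_coef (fun s => T 'X^s) (tens y f) (tens y' f') = tens (br y y') (T (f * f')).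
Proof.
move=> sf sf'; apply/ffunP => k; rewrite !ffunE.
have expand (g : {poly K}) : (size g <= n)%N -> g = \sum_(i < n) g`_i *: 'X^i.
  move=> sg; rewrite -poly_def; apply/polyP => i; rewrite coef_poly.
  by case: ltnP => // le_ni; rewrite nth_default // (leq_trans sg).
rewrite {2}(expand f sf) {2}(expand f' sf') mulr_suml linear_sum coef_sum scaler_suml.
apply: eq_bigr => i _; rewrite mulr_sumr linear_sum coef_sum scaler_suml.
apply: eq_bigr => j _; rewrite !ffunE (br_scalel skbr) (br_scaler skbr) -scalerAl -scalerAr -exprD !linearZ /=.
by rewrite !coefZ !scalerA mulrA.
Qed.

Lemma br_mod_skew p : skew_bilinear (br_mod br p : W -> W -> W).
Proof. exact: (br_coef_skew (fun s => 'X^s %% p)). Qed.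

Lemma br_mod_tens p y y' (f f' : {poly K}) :
  (size f <= n)%N -> (size f' <= n)%N ->
  br_mod br p (tens y f) (tens y' f') = tens (br y y') ((f * f') %% p).
Proof.
have lin : linear (fun f : {poly K} => f %% p) by move=> a g h; rewrite modpD modpZl.
pose T := HB.pack_for {linear {poly K} -> {poly K}} (fun f : {poly K} => f %% p)
  (GRing.isLinear.Build K {poly K} {poly K} *:%R _ lin).
exact: (br_coef_tens T).
Qed.

(** Minus the derivative with respect to c of the bracket modulo p + c l, see
    [gram_pencil]. *)
Definition br_lim p l := br_coef (fun s => ('X^s %/ p) * l).

Lemma br_lim_skew p l : skew_bilinear (br_lim p l).
Proof. exact: br_coef_skew. Qed.

Lemma br_lim_tens p l y y' (f f' : {poly K}) :
  (size f <= n)%N -> (size f' <= n)%N ->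
  br_lim p l (tens y f) (tens y' f') = tens (br y y') (((f * f') %/ p) * l).
Proof.
have lin : linear (fun f : {poly K} => (f %/ p) * l).
  by move=> a g h; rewrite divpD divpZl mulrDl scalerAl.
pose T := HB.pack_for {linear {poly K} -> {poly K}} (fun f : {poly K} => (f %/ p) * l)
  (GRing.isLinear.Build K {poly K} {poly K} *:%R _ lin).
exact: (br_coef_tens T).
Qed.

(** A point x of the dual of W and a polynomial f give the point
    y |-> x (y f) of the dual of q. All forms on W considered below are
    described by Lie-Poisson forms of q at such points, see [gram_tens]. *)
Definition current_at (x : 'I_(\dim {:W}) -> K) (f : {poly K}) (i : 'I_N) : K :=
  form_at x (tens (e i) f).

Lemma form_at_tens x y f : form_at x (tens y f) = form_at (current_at x f) y.
Proof. by rewrite {1}(sum_coord y) tens_suml form_at_lin form_at_sum. Qed.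

Lemma gram_currentZ x a f :
  gram br (current_at x (a *: f)) = a *: gram br (current_at x f).
Proof.
apply/matrixP => i j; rewrite !mxE /form_at mulr_sumr; apply: eq_bigr => b _.
by rewrite /current_at tensZr form_atZ mulrA.
Qed.

Lemma gram_current0 x f : f = 0 -> gram br (current_at x f) = 0.
Proof. by move=> ->; rewrite -(scale0r 0) gram_currentZ scale0r. Qed.

Lemma gram_tens p x y y' (f f' : {poly K}) :
  (size f <= n)%N -> (size f' <= n)%N ->
  (coord_row (tens y f) *m gram (br_mod br p) x *m (coord_row (tens y' f'))^T) 0 0 =
  (coord_row y *m gram br (current_at x ((f * f') %% p)) *m (coord_row y')^T) 0 0.
Proof.
move=> sf sf'; rewrite (gram_br (br_mod_skew p)).
by rewrite br_mod_tens // form_at_tens gram_br.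
Qed.

Lemma gram_lim_tens p l x y y' (f f' : {poly K}) :
  (size f <= n)%N -> (size f' <= n)%N ->
  (coord_row (tens y f) *m gram (br_lim p l) x *m (coord_row (tens y' f'))^T) 0 0 =
  (coord_row y *m gram br (current_at x (((f * f') %/ p) * l)) *m (coord_row y')^T) 0 0.
Proof.
move=> sf sf'; rewrite (gram_br (br_lim_skew p l)).
by rewrite br_lim_tens // form_at_tens gram_br.
Qed.

(** If f = u p + r with r the remainder, then f = u (p + c l) + (r - c u l).
    For f of degree at most 2n - 2 the quotient u has degree at most n - 2,
    so u l has degree less than n and r - c u l is the remainder modulo
    p + c l. *)
Lemma gram_pencil p l c x : p \is monic -> size p = n.+1 -> (2 <= n)%N -> (size l <= 2)%N ->
  gram (br_mod br (p + c *: l)) x = gram (br_mod br p) x - c *: gram (br_lim p l) x.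
Proof.
move=> mp sp n2 sl; apply/matrixP => i j; rewrite !mxE.
set u := basis_vec i; set v := basis_vec j.
transitivity (form_at x (br_mod br p u v - c *: br_lim p l u v)); last exact: form_at_subZ.
congr (form_at x _); apply/ffunP => k; rewrite !ffunE scaler_sumr -sumrB; apply: eq_bigr => a _ /=.
rewrite scaler_sumr -sumrB; apply: eq_bigr => b _ /=.
rewrite scalerA -scalerBl -coefZ -coefB; congr (_`_k *: _).
rewrite scalerAr.
have [_ spc] := monic_pencil c n2 mp sp sl.
have ab : (size ('X^(a + b) : {poly K}) <= n + n.-1)%N.
  by rewrite size_polyXn; have := ltn_ord a; have := ltn_ord b; lia.
set f := 'X^(a + b) in ab *.
have sdiv : (size (f %/ p)%R <= n.-1)%N.
  by rewrite size_divp ?monic_neq0 // sp /= leq_subLR.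
rewrite {1}(divp_eq f p).
have -> : f %/ p * p + f %% p = (f %/ p) * (p + c *: l) + (f %% p - (f %/ p) * (c *: l)).
  by rewrite mulrDr addrACA subrr addr0 addrC.
rewrite modpD modp_mull add0r modp_small // spc ltnS.
apply: leq_trans (size_polyD _ _) _; rewrite size_polyN geq_max; apply/andP; split.
  by rewrite -ltnS -sp ltn_modp monic_neq0.
apply: leq_trans (size_polyMleq _ _) _.
have : (size (c *: l) <= 2)%N by apply: leq_trans (size_scale_leq _ _) sl.
by move: sdiv; move: (size _) (size (c *: l)) => s1 s2; lia.
Qed.

End Current.

(** * Gram matrices in the presence of roots *)

Section Roots.
Variables (K : fieldType) (q : vectType K) (br : q -> q -> q) (n : nat).
Hypothesis skbr : skew_bilinear br.
Local Notation W := (Wspace q n).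
Local Notation e := (@basis_vec K q).
Local Notation N := (\dim {:q}).
Implicit Types (p l f g : {poly K}) (x : 'I_(\dim {:W}) -> K).

(** Picking an invertible minor of maximal size in each diagonal block
    reduces this to [triangular_rank]. *)
Lemma block_triangular_rank (br' : W -> W -> W) (T : {poly K} -> {poly K}) x b (R : nat)
    (f g : 'I_b -> {poly K}) :
  (forall y y' k k', (coord_row (tens n y (f k)) *m gram br' x *m (coord_row (tens n y' (g k')))^T) 0 0 =
     (coord_row y *m gram br (current_at x (T (f k * g k'))) *m (coord_row y')^T) 0 0) ->
  (forall k k' : 'I_b, (k' < k)%N -> T (f k * g k') = 0) ->
  (forall k, (R <= \rank (gram br (current_at x (T (f k * g k)%R))))%N) ->
  (b * R <= \rank (gram br' x))%N.
Proof.
move=> gramE low hR.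
have /choice[C hC] : forall k : 'I_b, exists CD : 'M[K]_(R, N) * 'M[K]_(N, R),
    CD.1 *m gram br (current_at x (T (f k * g k))) *m CD.2 = 1%:M.
  by move=> k; have [C [D CD]] := rank_unit_minor (hR k); exists (C, D).
have := @triangular_rank K _ (gram br' x) ('I_b * 'I_R)%type (fun i => i.1)
  (fun i => coord_row (tens n (vec_of (row i.2 (C i.1).1)) (f i.1)))
  (fun i => coord_row (tens n (vec_of (col i.2 (C i.1).2)^T) (g i.1))).
rewrite card_prod !card_ord; apply.
- move=> [k a] [k' c] /= lt.
  by rewrite gramE low // gram_current0 // mulmx0 mul0mx mxE.
- move=> [k a] [k' c] /= /val_inj <-; rewrite gramE !coord_row_vec_of trmxK.
  transitivity (((C k).1 *m gram br (current_at x (T (f k * g k))) *m (C k).2) a c); last first.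
    by rewrite hC mxE xpair_eqE eqxx.
  rewrite -row_mul [LHS]mxE [RHS]mxE; apply: eq_bigr => j _.
  by rewrite [(row _ _) 0 j]mxE [(col _ _) j 0]mxE.
Qed.

(** For deg (f g) < n the quotient by p is 0 and for f g = t^n it is 1. The
    bases t^(n-1), ..., t and t, ..., t^(n-1) of the complement of the
    constants thus make the form block triangular, with the form of q at the
    point given by l on the diagonal. *)
Lemma gram_lim_rank_ge p l x R : p \is monic -> size p = n.+1 ->
  (R <= \rank (gram br (current_at x l)))%N ->
  (n.-1 * R <= \rank (gram (br_lim br p l) x))%N.
Proof.
move=> mp sp hR.
have := (@block_triangular_rank (br_lim br p l) (fun f => (f %/ p) * l) x n.-1 R
   (fun k => 'X^(n.-1 - k)) (fun k => 'X^(k.+1))); apply.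
- move=> y y' k k'; rewrite gram_lim_tens ?size_polyXn //; have := ltn_ord k; have := ltn_ord k'; lia.
- move=> k k' lt; rewrite -exprD divp_small ?mul0r // size_polyXn sp.
  by have := ltn_ord k; lia.
- move=> k; rewrite -exprD.
  have -> : (n.-1 - k + k.+1)%N = n by have := ltn_ord k; lia.
  suff -> : 'X^n %/ p = 1 by rewrite mul1r.
  have -> : 'X^n = p + ('X^n - p) by rewrite addrC subrK.
  have szr : (size ('X^n - p)%R < size p)%N.
    rewrite sp ltnS; apply/leq_sizeP => j; rewrite coefB coefXn leq_eqVlt => /predU1P[<-|lt].
      by move/monicP: mp; rewrite lead_coefE sp /= => ->; rewrite eqxx subrr.
    by rewrite gtn_eqF // nth_default ?sp // subrr.
  by rewrite divpD divpp ?monic_neq0 // divp_small ?addr0.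
Qed.

Variable rs : seq K.
Hypothesis size_rs : size rs = n.
Let P := \prod_(z <- rs) ('X - z%:P).
(** The partial products of the linear factors of P from the left form a flag
    of ideals of K[t]/(P), and the partial products from the right a dual
    flag. The product of the k-th members is the cofactor P / (t - z_k). *)
Definition lprod (k : nat) : {poly K} := \prod_(z <- take k rs) ('X - z%:P).
Definition rprod (k : nat) : {poly K} := \prod_(z <- drop k.+1 rs) ('X - z%:P).

Lemma cofactorE k : (k < n)%N -> lprod k * rprod k * ('X - (rs`_k)%:P) = P.
Proof.
move=> lt_k; rewrite /P -[in RHS](cat_take_drop k rs) big_cat /= -mulrA; congr (_ * _).
by rewrite (drop_nth 0) ?size_rs // big_cons mulrC.
Qed.

Lemma lprod_rprod_dvd k k' : (k' < k)%N -> (k <= n)%N -> P %| lprod k * rprod k'.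
Proof.
move=> lt_k le_k; rewrite /lprod.
have -> : take k rs = take k'.+1 rs ++ drop k'.+1 (take k rs).
  by rewrite -{1}(cat_take_drop k'.+1 (take k rs)) take_takel.
rewrite big_cat /= mulrAC /P -{1}(cat_take_drop k'.+1 rs) big_cat /=.
exact: dvdp_mulIl.
Qed.

Lemma size_lprod k : (k < n)%N -> (size (lprod k) <= n)%N.
Proof. by move=> lt_k; rewrite size_prod_XsubC size_take size_rs lt_k. Qed.

Lemma size_rprod k : (k < n)%N -> (size (rprod k) <= n)%N.
Proof. by move=> lt_k; rewrite size_prod_XsubC size_drop size_rs; lia. Qed.

Lemma size_P : size P = n.+1.
Proof. by rewrite size_prod_XsubC size_rs. Qed.

Lemma monic_cofactor k : lprod k * rprod k \is monic.
Proof. by rewrite monicMr ?monic_prod_XsubC. Qed.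

Lemma size_cofactor k : (k < n)%N -> size (lprod k * rprod k) = n.
Proof.
move=> lt_k; have := size_P; rewrite -(cofactorE lt_k).
rewrite (size_monicM (monic_cofactor k)) ?polyXsubC_eq0 // size_XsubC.
by rewrite addn2 /= => -[].
Qed.

Lemma cofactor_mod k : (k < n)%N -> (lprod k * rprod k) %% P = lprod k * rprod k.
Proof. by move=> lt_k; rewrite modp_small // size_P size_cofactor. Qed.

(** With respect to the bases of partial products the Lie-Poisson form is
    block triangular, whatever the multiplicities of the roots: the products
    below the diagonal are divisible by P, and the diagonal blocks are the
    forms of q at the points given by the cofactors. *)
Lemma gram_mod_rank_ge x R :
  (forall k, (k < n)%N -> R <= \rank (gram br (current_at x (lprod k * rprod k)%R)))%N ->
  (n * R <= \rank (gram (br_mod br P) x))%N.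
Proof.
move=> hR.
apply: (@block_triangular_rank _ (fun f => f %% P) x n R (fun k => lprod k) (fun k => rprod k)).
- by move=> y y' k k'; rewrite gram_tens ?size_lprod ?size_rprod.
- move=> k k' lt; apply/modp_eq0P; apply: lprod_rprod_dvd lt (ltnW _) => //.
- by move=> k; rewrite cofactor_mod ?hR.
Qed.

(** The cofactor P / (t - z) is an eigenvector for multiplication in
    K[t]/(P): f acts on it by f(z). *)
Lemma cofactor_mul k f : (k < n)%N ->
  (lprod k * rprod k * f) %% P = f.[rs`_k] *: (lprod k * rprod k).
Proof.
move=> lt_k.
have [g fE] : exists g, f = g * ('X - (rs`_k)%:P) + (f.[rs`_k])%:P.
  have : root (f - (f.[rs`_k])%:P) rs`_k by rewrite /root !hornerE subrr.
  by move/factor_theorem => [g gE]; exists g; rewrite -gE subrK.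
rewrite {1}fE mulrDr modpD mulrCA cofactorE // modp_mull add0r.
by rewrite mulrC mul_polyC modpZl cofactor_mod.
Qed.

(** By [cofactor_mul], bracketing y P/(t - z) with w only sees the value
    of w at t = z. *)
Lemma cofactor_ker k x y : (k < n)%N ->
  coord_row y *m gram br (current_at x (lprod k * rprod k)) = 0 ->
  coord_row (tens n y (lprod k * rprod k)) *m gram (br_mod br P) x = 0.
Proof.
move=> lt_k h; apply/rowP => j; rewrite [RHS]mxE.
set v := coord_row _ *m _; have -> : v 0 j = (v *m (coord_row (basis_vec j))^T) 0 0.
  by rewrite coord_row_e trmx_delta -colE [RHS]mxE.
rewrite {1}(tens_sum (basis_vec j)) linear_sum linear_sum mulmx_sumr summxE big1 // => i _.
rewrite gram_tens ?size_cofactor ?size_polyXn // cofactor_mul // gram_currentZ.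
by rewrite -scalemxAr h scaler0 mul0mx mxE.
Qed.

Definition evW (z : K) (w : W) : q := \sum_(j < n) z ^+ j *: w j.

Lemma evW_linear z : linear (evW z).
Proof.
move=> a u v; rewrite /evW scaler_sumr -big_split; apply: eq_bigr => j _ /=.
by rewrite !ffunE scalerDr !scalerA mulrC.
Qed.

Lemma evW_tens z y f : (size f <= n)%N -> evW z (tens n y f) = f.[z] *: y.
Proof.
move=> sf; rewrite (horner_coef_wide z sf) scaler_suml; apply: eq_bigr => j _.
by rewrite ffunE scalerA mulrC.
Qed.

(** Evaluation at the k-th root kills all cofactors but the k-th. *)
Lemma cofactor_free (R : nat) (Y : 'I_n -> 'M[K]_(R, N)) (c : 'I_n * 'I_R -> K) : uniq rs ->
  (forall k, row_free (Y k)) ->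
  \sum_i c i *: coord_row (tens n (vec_of (row i.2 (Y i.1))) (lprod i.1 * rprod i.1)) = 0 ->
  forall i, c i = 0.
Proof.
move=> urs Yfree c0 [k a].
have {}c0 : \sum_i c i *: tens n (vec_of (row i.2 (Y i.1))) (lprod i.1 * rprod i.1) = 0.
  apply: coord_row_inj; rewrite linear_sum -[RHS]c0; apply: eq_bigr => i _.
  by rewrite linearZ.
pose z := rs`_k.
pose E := HB.pack_for {linear W -> q} (evW z)
  (GRing.isLinear.Build K W q *:%R _ (evW_linear z)).
have := congr1 E c0; rewrite linear0 linear_sum.
have -> : \sum_i E (c i *: tens n (vec_of (row i.2 (Y i.1))) (lprod i.1 * rprod i.1)) =
    \sum_(k' < n) \sum_(a' < R) c (k', a') *: ((lprod k' * rprod k').[z] *: vec_of (row a' (Y k'))).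
  rewrite [RHS]pair_bigA; apply: eq_bigr => -[k' a'] _ /=.
  have := linearZ_LR E (c (k', a')) (tens n (vec_of (row a' (Y k'))) (lprod k' * rprod k')).
  by rewrite /= evW_tens ?size_cofactor.
rewrite (bigD1 k) //= [X in _ + X]big1 ?addr0; last first.
  move=> k' ne; apply: big1 => a' _.
  suff -> : (lprod k' * rprod k').[z] = 0 by rewrite scale0r scaler0.
  have : P.[z] = 0.
    by apply/eqP; rewrite -/(root P z) root_prod_XsubC mem_nth ?size_rs.
  rewrite -(cofactorE (ltn_ord k')) hornerM hornerXsubC => /eqP.
  rewrite mulf_eq0 subr_eq0 nth_uniq ?size_rs // [_ == _ :> nat]eq_sym.
  by rewrite [_ == _ :> nat](inj_eq val_inj) (negPf ne) orbF => /eqP.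
under eq_bigr do rewrite scalerA mulrC -scalerA.
rewrite -scaler_sumr => /eqP; rewrite scaler_eq0.
have -> : ((lprod k * rprod k).[z] == 0) = false.
  move: urs; rewrite -{1}(cat_take_drop k rs) (drop_nth 0) ?size_rs // cat_uniq.
  rewrite /= negb_or => /and3P[_ /andP[zl _] /andP[zr _]].
  apply/negbTE; rewrite hornerM mulf_neq0 // -/(root _ _) root_prod_XsubC //.
move=> /= /eqP/(congr1 (@coord_row K q)); rewrite linear0 linear_sum => h.
have : (\row_a c (k, a)) *m Y k = 0.
  rewrite mulmx_sum_row -[RHS]h; apply: eq_bigr => a' _.
  by rewrite linearZ /= coord_row_vec_of [(\row__ _) 0 a']mxE.
by move/(row_free_eq0 (Yfree k))/rowP/(_ a); rewrite !mxE.
Qed.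

End Roots.


Section Family.
Variables (K : fieldType) (m : nat).

Lemma family_free (I : finType) (f : I -> 'rV[K]_m) :
  (forall c : I -> K, \sum_i c i *: f i = 0 -> forall i, c i = 0) ->
  row_free (\matrix_(a < #|I|) f (enum_val a)).
Proof.
move=> h; apply: row_free_of_ker => c; rewrite mulmx_sum_row => c0.
have /h h0 : \sum_i c 0 (enum_rank i) *: f i = 0.
  rewrite -[RHS]c0 (reindex (@enum_val I I)) /=; last first.
    by apply: onW_bij; apply: enum_val_bij.
  by apply: eq_bigr => a _; rewrite enum_valK rowK.
by apply/rowP => a; rewrite mxE -(h0 (enum_val a)) enum_valK.
Qed.
End Family.

Section Lift.
Variables (K : fieldType) (q : vectType K) (br : q -> q -> q) (n : nat).
Hypothesis skbr : skew_bilinear br.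
Local Notation W := (Wspace q n).
Local Notation e := (@basis_vec K q).
Local Notation N := (\dim {:q}).
Implicit Types (p l f g : {poly K}) (x : 'I_(\dim {:W}) -> K).

Lemma dim_W : \dim {:W} = (n * N)%N.
Proof. by rewrite !dimvf /dim /= card_ord. Qed.

Lemma tens_vec_of (c : 'rV[K]_N) f :
  tens n (vec_of c) f = \sum_i c 0 i *: tens n (e i) f.
Proof. exact: tens_suml. Qed.

(** The image of F under the algebra morphism that extends y |-> y f. *)
Definition sym_tens (F : symalg q) f : symalg W :=
  F \mPo [tuple sym_incl (tens n (e i) f) | i < N].

Lemma grad_sym_incl (v : W) x : grad (sym_incl v) x = coord_row v.
Proof.
apply/rowP => j; rewrite gradE mxE /sym_incl (raddf_sum (mderiv j)) (raddf_sum (meval x)) /= (bigD1 j) //=.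
rewrite mderivZ mevalZ -gradE grad_e mxE !eqxx mulr1 big1 ?addr0 // => i ne.
by rewrite mderivZ mevalZ -gradE grad_e mxE eqxx /= eq_sym (negPf ne) mulr0.
Qed.

Lemma grad_sym_tens F f x : grad (sym_tens F f) x = coord_row (tens n (vec_of (grad F (current_at x f))) f).
Proof.
apply/rowP => j; rewrite gradE mderiv_comp_mpoly tens_vec_of (linear_sum (@coord_row K W)) summxE.
rewrite (raddf_sum (meval x)).
apply: eq_bigr => i _; rewrite /= mevalM comp_mpoly_meval tnth_mktuple.
rewrite -[(sym_incl _)^`M(j).@[x]]gradE grad_sym_incl.
rewrite linearZ /= [RHS]mxE; congr (_ * _); rewrite gradE.
by apply: meval_eq => a; rewrite tnth_mktuple sym_incl_ev.
Qed.

Variable rs : seq K.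
Hypothesis size_rs : size rs = n.
Local Notation P := (\prod_(z <- rs) ('X - z%:P)).
Local Notation cof k := (lprod rs k * rprod rs k).

(** For distinct roots the cofactors are, up to scalars, the primitive
    idempotents of K[t]/(P), so this transports invariants from the factors of
    q[t]/(P), a sum of n copies of q. *)
Lemma sym_tens_centre F k : [pchar K] =i pred0 -> (k < n)%N -> sym_invariants br F ->
  poisson_centre (br_mod br P) (sym_tens F (cof k)).
Proof.
move=> charK lt_k invF; apply: (grad_centre charK) => x.
by rewrite grad_sym_tens cofactor_ker // coord_row_vec_of (invariants_grad invF).
Qed.

(** Kernel vectors of the forms of q at the points given by the cofactors
    add up to independent kernel vectors of the form of W. *)
Lemma cofactor_kermx (r : nat) (Y : 'I_n -> 'M[K]_(r, N)) x : uniq rs ->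
  (forall k, row_free (Y k)) -> (forall k, Y k *m gram br (current_at x (cof k)) = 0) ->
  let D := \matrix_(a < #|{: 'I_n * 'I_r}|)
    coord_row (tens n (vec_of (row (enum_val a).2 (Y (enum_val a).1))) (cof (enum_val a).1)) in
  row_free D /\ D *m gram (br_mod br P) x = 0.
Proof.
move=> urs Yfree Y0 /=; split.
  apply: (@family_free _ _ _ (fun i : 'I_n * 'I_r =>
    coord_row (tens n (vec_of (row i.2 (Y i.1))) (cof i.1)))) => c.
  exact: cofactor_free.
apply/row_matrixP => a; rewrite row_mul rowK row0 cofactor_ker // coord_row_vec_of.
by rewrite -row_mul Y0 row0.
Qed.

(** At distinct roots, every copy of q contributes a stabilizer of dimension
    at least ind q. *)
Lemma gram_mod_rank_le (r : nat) x : uniq rs ->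
  (forall y : 'I_N -> K, (\rank (gram br y) <= N - r)%N) -> (r <= N)%N ->
  (\rank (gram (br_mod br P) x) + n * r <= \dim {:W})%N.
Proof.
move=> urs rk le_r.
have /choice[Y hY] : forall k : 'I_n, exists Y : 'M[K]_(r, N),
    row_free Y /\ Y *m gram br (current_at x (cof k)) = 0.
  move=> k; have : (r <= \rank (kermx (gram br (current_at x (cof k)))))%N.
    rewrite mxrank_ker; have := rk (current_at x (cof k)).
    by move: (\rank _) => t; lia.
  by move=> /row_free_sub[Y Yfree /sub_kermxP Y0]; exists Y.
have [] := @cofactor_kermx r Y x urs (fun k => (hY k).1) (fun k => (hY k).2).
set D := \matrix_(_ < _) _ => Dfree /sub_kermxP/mxrankS.
rewrite (eqP Dfree) card_prod !card_ord mxrank_ker.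
by rewrite leq_subRL ?rank_leq_row.
Qed.

End Lift.

Section SpecialPoint.
Variables (K : fieldType) (q : vectType K) (n : nat).
Local Notation W := (Wspace q n).
Local Notation e := (@basis_vec K q).
Local Notation N := (\dim {:q}).

(** W is a direct sum of n copies of q, so the points of its dual are free
    families of n points of the dual of q. *)
Lemma point_of_coefs (z : 'I_n -> 'I_N -> K) :
  exists x : 'I_(\dim {:W}) -> K, forall f i, current_at x f i = \sum_(k < n) f`_k * z k i.
Proof.
exists (fun j => \sum_k form_at (z k) ((basis_vec j : W) k)) => f i.
have ev (w : W) : form_at (fun j => \sum_k form_at (z k) ((basis_vec j : W) k)) w = \sum_k form_at (z k) (w k).
  rewrite {2}(sum_coord w) form_at_sum.
  under eq_bigr do rewrite mulr_sumr.
  rewrite exchange_big; apply: eq_bigr => k _ /=; rewrite sum_ffunE.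
  under [in RHS]eq_bigr do rewrite ffunE.
  by rewrite form_at_lin.
by rewrite /current_at ev; apply: eq_bigr => k _; rewrite ffunE form_atZ form_at_e.
Qed.
End SpecialPoint.

Section GoodParameters.
Variables (K : closedFieldType) (charK : [pchar K] =i pred0).

(** A double root s of p + c l satisfies p(s) = - c l(s) and
    p'(s) = - c l'(s), hence is a root of w = p' l - p l'. This polynomial is
    not zero because p is not proportional to l, and each of its roots
    determines c, as l and l' have no common root. *)
Lemma separable_pencil (n : nat) (p l : {poly K}) : (2 <= n)%N -> p \is monic ->
  size p = n.+1 -> l != 0 -> (size l <= 2)%N ->
  exists T : seq K, forall c, c \notin T ->
    exists rs : seq K, [/\ uniq rs, size rs = n & p + c *: l = \prod_(z <- rs) ('X - z%:P)].
Proof.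
move=> n2 mp sp nzl sl.
have n_neq0 k : (k.+1%:R == 0 :> K) = false by rewrite ((pcharf0P K).1 charK).
pose w := p^`() * l - p * l^`().
have lE : l = l`_1 *: 'X + (l`_0)%:P.
  apply/polyP => -[|[|i]]; rewrite coefD coefZ coefX coefC /= ?mulr0 ?mulr1 ?add0r ?addr0 //.
  by rewrite nth_default // (leq_trans sl).
have dlE : l^`() = (l`_1)%:P by rewrite lE derivD derivZ derivX derivC addr0 alg_polyC coefD coefZ coefX coefC mulr1 addr0.
(* The coefficient of t^n in w is (n - 1) l_1; if l_1 = 0, that of t^(n-1) is
   n l_0. *)
have nzw : w != 0.
  case: n n2 sp => [|[|k]] // _ sp.
  have pk : p`_k.+2 = 1 by move/monicP: mp; rewrite lead_coefE sp.
  have wn : w`_k.+2 = k.+1%:R * l`_1.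
    rewrite coefB dlE coefMC pk mul1r {1}lE mulrDr coefD coefMC -scalerAr coefZ coefMX /=.
    rewrite !coef_deriv pk [p`_k.+3]nth_default ?sp // mul0rn mul0r addr0.
    by rewrite -!natr1; ring.
  case: (eqVneq l`_1 0) => [l1|nz1].
    have nz0 : l`_0 != 0 by apply: contraNneq nzl => l0; rewrite lE l1 l0 scale0r addr0.
    have wn1 : w`_k.+1 = k.+2%:R * l`_0.
      rewrite coefB dlE coefMC l1 mulr0 subr0 lE l1 scale0r add0r coefMC coefC /= coef_deriv pk.
      by [].
    by apply: contraTneq nz0 => w0; move/eqP: wn1; rewrite w0 coef0 eq_sym mulf_eq0 n_neq0 /= negbK.
  by apply: contraTneq nz1 => w0; move/eqP: wn; rewrite w0 coef0 eq_sym mulf_eq0 n_neq0 /= negbK.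
have [ws wsE] := closed_field_poly_normal w.
pose T := [seq - p.[s] / l.[s] | s <- ws] ++ [seq - p^`().[s] / l^`().[s] | s <- ws].
exists T => c; rewrite mem_cat negb_or => /andP[c1 c2].
have [mpc spc] := monic_pencil c n2 mp sp sl.
have [rs] := closed_field_poly_normal (p + c *: l); rewrite (monicP mpc) scale1r => rsE.
exists rs; split=> //; last first.
  by have := spc; rewrite rsE size_prod_XsubC => -[].
rewrite -separable_prod_XsubC -rsE separable_poly.unlock.
apply/coprimepP => d dP dP'; apply: contrapT => nd.
have /closed_rootP[s ds] : size d != 1%N by apply/negP => h; apply: nd; rewrite -size_poly_eq1.
have rP : (p + c *: l).[s] = 0 by apply/eqP; exact: (root_dvdp dP ds).
have rP' : (p^`() + c *: l^`()).[s] = 0.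
  by apply/eqP; move: dP'; rewrite derivD derivZ => dP'; exact: (root_dvdp dP' ds).
move: rP rP'; rewrite !hornerE => /eqP; rewrite addr_eq0 => /eqP ps /eqP; rewrite addr_eq0 => /eqP ps'.
have sw : s \in ws.
  have : root w s by rewrite /root /w !hornerE ps ps'; apply/eqP; ring.
  by rewrite wsE rootZ ?lead_coef_eq0 // root_prod_XsubC.
case: (eqVneq l.[s] 0) => [ls|ls]; last first.
  by case/mapP: c1; exists s => //; rewrite ps opprK mulfK.
case/mapP: c2; exists s => //; rewrite ps' opprK mulfK // dlE hornerC.
apply: contraNneq nzl => l1; move: ls; rewrite lE l1 scale0r add0r hornerC => ->.
by rewrite polyC0.
Qed.
End GoodParameters.

Section PencilGradients.
Variables (K : fieldType) (charK : [pchar K] =i pred0) (q : vectType K) (br : q -> q -> q) (n : nat).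
Local Notation W := (Wspace q n).
Implicit Types (x : 'I_(\dim {:W}) -> K) (H : symalg W).

(** The differential of a polynomial expression in generators is a
    combination of the differentials of the generators, and only finitely
    many members of the pencil occur in it. *)
Lemma Zpencil_grad (p l : {poly K}) H : @Zpencil K q br n p (p + l) H ->
  exists T : seq K, forall x,
    (grad H x <= \sum_(c <- T) kermx (gram (br_mod br (p + c *: l)) x))%MS.
Proof.
elim=> {H} [H [a Ha] | c | F G _ [T1 h1] _ [T2 h2] | F G _ [T1 h1] _ [T2 h2]].
- exists [:: 1 - a] => x; rewrite big_seq1.
  have <- : a *: p + (1 - a) *: (p + l) = p + (1 - a) *: l.
    by rewrite scalerDr addrA -scalerDl (addrC a) subrK scale1r.
  by apply/sub_kermxP/centre_grad.
- exists [::] => x; rewrite big_nil.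
  suff -> : grad (c%:MP : symalg W) x = 0 by apply: sub0mx.
  by apply/rowP => j; rewrite gradE mderivC meval0 mxE.
- exists (T1 ++ T2) => x; rewrite big_cat /=.
  have -> : grad (F + G) x = grad F x + grad G x.
    by apply/rowP => j; rewrite !mxE mderivD mevalD.
  by apply: addmx_sub_adds.
- exists (T1 ++ T2) => x; rewrite big_cat /=.
  have -> : grad (F * G) x = G.@[x] *: grad F x + F.@[x] *: grad G x.
    by apply/rowP => j; rewrite !mxE mderivM mevalD !mevalM mulrC.
  by apply: addmx_sub_adds; apply: scalemx_sub.
Qed.
End PencilGradients.

(** * The pencil of a pair of polynomials and a special point *)

Section Main.
Variables (K : closedFieldType) (charK : [pchar K] =i pred0) (q : vectType K).
Variables (br : q -> q -> q) (lie : is_lie_bracket br) (n : nat) (n_ge2 : (2 <= n)%N).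
Variables (p l : {poly K}) (monic_p : p \is monic) (size_p : size p = n.+1).
Variables (l_neq0 : l != 0) (size_l : (size l <= 2)%N).
Local Notation W := (Wspace q n).
Local Notation e := (@basis_vec K q).
Local Notation N := (\dim {:q}).
Local Notation m := (\dim {:W}).
Local Notation r0 := (ind br).
Local Notation R := (N - r0)%N.
Implicit Types (x : 'I_m -> K) (f g : {poly K}).
Let skbr := lie_skew_bilinear lie.

Definition gram_base x : 'M[K]_m := gram (br_mod br p) x.
(** The sign makes A + c B the form at parameter c, see [gram_affine]. *)
Definition gram_slope x : 'M[K]_m := - gram (br_lim br p l : W -> W -> W) x.

Lemma gram_affine x c : gram (br_mod br (p + c *: l)) x = gram_base x + c *: gram_slope x.
Proof. by rewrite gram_pencil // scalerN. Qed.

Lemma gram_base_skew x : (gram_base x)^T = - gram_base x.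
Proof. by exact: (gram_skew (br_mod_skew n skbr p) x). Qed.

Lemma gram_slope_skew x : (gram_slope x)^T = - gram_slope x.
Proof. by rewrite /gram_slope linearN; congr (- _); exact: (gram_skew (br_lim_skew n skbr p l) x). Qed.

(** The constants, a subspace isomorphic to q in the kernel of the form at
    infinity. They cause the only drop of rank along the pencil. *)
Definition const_currents : 'M[K]_(N, m) := \matrix_i coord_row (tens n (e i) 1).
Local Notation Q := const_currents.

Let size1_le : (size (1%R : {poly K}) <= n)%N.
Proof. by rewrite size_poly1 (leq_trans _ n_ge2). Qed.

Lemma const_currents_gram_slope x : Q *m gram_slope x = 0.
Proof.
rewrite mulmxN; apply/eqP; rewrite oppr_eq0; apply/eqP/row_matrixP => i.
rewrite row_mul rowK row0; apply/rowP => j; rewrite [RHS]mxE.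
set v := coord_row _ *m _; have -> : v 0 j = (v *m (coord_row (basis_vec j))^T) 0 0.
  by rewrite coord_row_e trmx_delta -colE [RHS]mxE.
rewrite {1}(tens_sum (basis_vec j)) linear_sum linear_sum mulmx_sumr summxE big1 // => k _.
rewrite (gram_lim_tens skbr) ?size_polyXn // mul1r gram_current0 ?mulmx0 ?mul0mx ?mxE //.
by rewrite divp_small ?mul0r // size_polyXn size_p ltnS ltn_ord.
Qed.

Lemma const_currents_gram_base x : Q *m gram_base x *m Q^T = gram br (current_at x 1).
Proof.
apply/matrixP => i j.
have -> : (Q *m gram_base x *m Q^T) i j = (row i Q *m gram_base x *m (row j Q)^T) 0 0.
  rewrite -row_mul [LHS]mxE [RHS]mxE; apply: eq_bigr => a _.
  by congr (_ * _); rewrite !mxE.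
rewrite !rowK (gram_tens skbr _ _ _ _ size1_le size1_le) mul1r modp_small ?size_p ?size_poly1 //.
by rewrite (gram_br skbr) mxE.
by rewrite ltnS ltnW.
Qed.

(** The rank is bounded by [gram_mod_rank_le] for almost all c, hence by
    [pencil_rank_le] for all c. *)
Lemma form_rank_le x c : (\rank (gram_base x + c *: gram_slope x)%R <= n * R)%N.
Proof.
have [T hT] := separable_pencil charK n_ge2 monic_p size_p l_neq0 size_l.
apply: (pencil_rank_le charK (T := T)) => {}c /hT[rs [urs srs rsE]].
have := @gram_mod_rank_le K q br n skbr rs srs r0 x urs (ind_rank_le lie) (ind_leq lie).
rewrite -rsE gram_affine; move: (\rank _) => t; rewrite dim_W mulnBr.
by have := leq_mul (leqnn n) (ind_leq lie); move: (n * _)%N (n * _)%N => a b; lia.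
Qed.

Lemma rank_current_scale x f a y : a != 0 -> current_at x f =1 (fun i => a * y i) ->
  \rank (gram br y) = R -> \rank (gram br (current_at x f)) = R.
Proof.
move=> nz fE ry; have -> : gram br (current_at x f) = a *: gram br y.
  apply/matrixP => i j; rewrite !mxE mulr_sumr; apply: eq_bigr => b _.
  by rewrite fE mulrA.
by rewrite (eqmx_scale _ nz).
Qed.

(** The point f |-> f_(n-1) u + (f_0 + mu f_1) v. The first coordinate is 1
    on monic polynomials of degree n - 1, such as the cofactors of p + c l,
    so all points of the dual of q that occur there lie on the line u + K v.
    The second coordinate is there for the constants and for l, the only
    polynomials that matter at infinity. *)
Lemma special_point (u v : 'I_N -> K) mu : exists x, forall f i,
  current_at x f i = f`_n.-1 * u i + (f`_0 + mu * f`_1) * v i.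
Proof.
have delta f j : (j < n)%N -> \sum_(k < n) f`_k * (k == j :> nat)%:R = f`_j.
  move=> lt_j; rewrite (bigD1 (Ordinal lt_j)) //= eqxx mulr1 big1 ?addr0 // => k ne.
  by rewrite (_ : (k == j :> nat) = (k == Ordinal lt_j)) // (negPf ne) mulr0.
have [x hx] := point_of_coefs (fun (k : 'I_n) (i : 'I_N) => (k == n.-1 :> nat)%:R * u i +
   ((k == 0 :> nat)%:R + mu * (k == 1 :> nat)%:R) * v i).
exists x => f i; rewrite hx -(delta f n.-1) -1?(delta f 0%N) -1?(delta f 1%N) ?ltn_predL ?(ltnW n_ge2) //.
rewrite mulr_sumr -big_split !mulr_suml -big_split; apply: eq_bigr => k _ /=.
ring.
Qed.

(** mu = 0 will do unless l is a multiple of t, in which case mu = 1 will. *)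
Lemma linear_form_neq0 : exists mu, l`_0 + mu * l`_1 != 0.
Proof.
case: (eqVneq l`_0 0) => [l0|nz0]; last by exists 0; rewrite mul0r addr0.
exists 1; rewrite l0 add0r mul1r; apply: contraNneq l_neq0 => l1.
apply/eqP/polyP => -[|[|i]]; rewrite coef0 //.
by rewrite nth_default // (leq_trans size_l).
Qed.

Section AtPoint.
Variables (u v : 'I_N -> K) (mu : K) (x : 'I_m -> K).
Hypothesis mu_l : l`_0 + mu * l`_1 != 0.
Hypothesis reg_v : \rank (gram br v) = R.
Hypothesis reg_uv : forall c, \rank (gram br (fun i => u i + c * v i)) = R.
Hypothesis current_x : forall f i, current_at x f i = f`_n.-1 * u i + (f`_0 + mu * f`_1) * v i.

Lemma current_cofactor rs k : size rs = n -> (k < n)%N ->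
  current_at x (lprod rs k * rprod rs k) =
  fun i => u i + ((lprod rs k * rprod rs k)`_0 + mu * (lprod rs k * rprod rs k)`_1) * v i.
Proof.
move=> srs lt_k; apply/funext => i; rewrite current_x; congr (_ + _).
have /monicP := monic_cofactor rs k; rewrite lead_coefE (size_cofactor srs) // => ->.
by rewrite mul1r.
Qed.

Lemma form_rank_point c : \rank (gram_base x + c *: gram_slope x)%R = (n * R)%N.
Proof.
apply/eqP; rewrite eqn_leq form_rank_le -gram_affine /=.
have [mpc spc] := monic_pencil c n_ge2 monic_p size_p size_l.
have [rs] := closed_field_poly_normal (p + c *: l); rewrite (monicP mpc) scale1r => rsE.
have srs : size rs = n by have := spc; rewrite rsE size_prod_XsubC => -[].
rewrite rsE; apply: (gram_mod_rank_ge skbr srs) => k lt_k.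
by rewrite current_cofactor // reg_uv.
Qed.

(** The point given by l is a nonzero combination of u and v, a multiple of v
    unless n = 2, and all these are regular. *)
Lemma gram_slope_rank_point : (n.-1 * R <= \rank (gram_slope x))%N.
Proof.
rewrite mxrank_opp; apply: (gram_lim_rank_ge skbr) => //.
pose b := l`_0 + mu * l`_1; suff -> : \rank (gram br (current_at x l)) = R by [].
case: (eqVneq l`_n.-1 0) => [ln|nz].
  apply: (rank_current_scale (a := b) (y := v)) => // i.
  by rewrite current_x ln mul0r add0r.
apply: (rank_current_scale (a := l`_n.-1) (y := fun i => u i + (l`_n.-1)^-1 * b * v i)) => // i.
by rewrite current_x mulrDr -mulrA mulVKf.
Qed.

Lemma const_currents_rank_point : \rank (Q *m gram_base x *m Q^T) = R.
Proof.
rewrite const_currents_gram_base; apply: (rank_current_scale (a := 1) (y := v)); rewrite ?oner_eq0 // => i.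
rewrite current_x !coef1 /= mulr0 addr0 !mul1r.
by case: n n_ge2 => [|[|k]] //= _; rewrite mul0r add0r.
Qed.
End AtPoint.

End Main.

(** * The two bounds *)

Section Bounds.
Variables (K : closedFieldType) (charK : [pchar K] =i pred0) (q : vectType K).
Variables (br : q -> q -> q) (lie : is_lie_bracket br) (n : nat) (n_ge2 : (2 <= n)%N).
Variables (p l : {poly K}) (monic_p : p \is monic) (size_p : size p = n.+1).
Variables (l_neq0 : l != 0) (size_l : (size l <= 2)%N).
Local Notation W := (Wspace q n).
Local Notation e := (@basis_vec K q).
Local Notation N := (\dim {:q}).
Local Notation m := (\dim {:W}).
Local Notation r0 := (ind br).
Local Notation R := (N - r0)%N.
Local Notation A := (@gram_base K q br n p).
Local Notation B := (@gram_slope K q br n p l).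
Local Notation Q := (@const_currents K q n).
Implicit Types (x : 'I_m -> K) (f g : {poly K}).
Let skbr := lie_skew_bilinear lie.

Let A_skew x : (A x)^T = - A x. Proof. exact: gram_base_skew. Qed.
Let B_skew x : (B x)^T = - B x. Proof. exact: gram_slope_skew. Qed.
Let QB x : Q *m B x = 0. Proof. exact: const_currents_gram_slope. Qed.
Let AB_le x c : (\rank (A x + c *: B x)%R <= n * R)%N. Proof. exact: form_rank_le. Qed.

(** A kernel vector w satisfies w A = - c w B, so orthogonality for B, known
    from [pencil_isotropic] and from B being zero on the constants, implies
    orthogonality for A. *)
Lemma ker_isotropic x (T : seq K) :
  {in T, forall c, (n * R <= \rank (A x + c *: B x)%R)%N} ->
  let L := (\sum_(c <- T) kermx (A x + c *: B x)%R)%MS in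
  L *m A x *m L^T = 0 /\ L *m A x *m Q^T = 0.
Proof.
move=> hT L.
have kerA c : kermx (A x + c *: B x) *m A x = - (c *: (kermx (A x + c *: B x) *m B x)).
  by apply/eqP; rewrite -addr_eq0 scalemxAr -mulmxDr mulmx_ker.
have sumT k (X : 'M[K]_(m, k)) :
    {in T, forall c, kermx (A x + c *: B x) *m X = 0} -> L *m X = 0.
  by move=> h; apply/sub_kermxP/seq_sumsmx_sub => c cT; apply/sub_kermxP/h.
split; last first.
  rewrite -mulmxA; apply: (sumT) => c _.
  by rewrite mulmxA kerA mulNmx -scalemxAl -mulmxA (skew_ker (B_skew x) (QB x)) mulmx0 scaler0 oppr0.
rewrite -mulmxA; apply: (sumT) => c cT.
rewrite mulmxA; apply: trmx_inj; rewrite trmx0 trmx_mul trmxK; apply: (sumT) => c' c'T.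
apply: trmx_inj; rewrite trmx0 trmx_mul trmxK kerA mulNmx -scalemxAl.
rewrite (pencil_isotropic charK (A_skew x) (B_skew x) (AB_le x) (hT c cT)
  (mulmx_ker _) (mulmx_ker (A x + c' *: B x))).
by rewrite scaler0 oppr0.
Qed.

(** The ranks found at one point x0 hold at a generic point x, where also the
    differentials of the F_i are independent. These lie in a sum of kernels
    to which [isotropic_rank_le] applies. *)
Lemma Zpencil_indep_le x0 k (F : k.-tuple (symalg W)) :
  (forall c, \rank (A x0 + c *: B x0)%R = (n * R)%N) ->
  \rank (Q *m A x0 *m Q^T) = R ->
  (forall i, @Zpencil K q br n p (p + l) (tnth F i)) -> alg_indep F ->
  (2 * k + n * R + R <= m + m)%N.
Proof.
move=> rk0 rQ0 FZ indF.
have [D nzD hD] := alg_indep_jac charK indF.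
have /choice[T hT] : forall i, exists T : seq K, forall x,
    (grad (tnth F i) x <= \sum_(c <- T) kermx (A x + c *: B x)%R)%MS.
  move=> i; have [T hT] := Zpencil_grad (FZ i); exists T => x.
  by under eq_bigr do rewrite -gram_affine //.
pose T1 := 0 :: flatten [seq T i | i <- enum 'I_k].
have /choice[J hJ] : forall c : K, exists J : {mpoly K[m]}, J != 0 /\
    forall x, J.@[x] != 0 -> (n * R <= \rank (A x + c *: B x)%R)%N.
  move=> c; have := @rank_open K m _ _ (gram_poly (br_mod br (p + c *: l) : W -> W -> W)) x0 (n * R)%N.
  rewrite gram_poly_ev gram_affine // rk0 => /(_ (leqnn _))[J Jx0 hJ]; exists J; split.
    by apply: contraNneq Jx0 => ->; rewrite meval0.
  by move=> x /hJ; rewrite gram_poly_ev gram_affine.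
have [JQ nzJQ hJQ] : exists2 J : {mpoly K[m]}, J != 0 &
    forall x, J.@[x] != 0 -> (R <= \rank (Q *m A x *m Q^T))%N.
  pose cst a b (X : 'M[K]_(a, b)) : 'M[{mpoly K[m]}]_(a, b) := map_mx (@mpolyC m K) X.
  pose M := cst _ _ Q *m gram_poly (br_mod br p : W -> W -> W) *m cst _ _ Q^T.
  have ME x : map_mx (meval x) M = Q *m A x *m Q^T.
    rewrite !map_mxM /= gram_poly_ev; congr (_ *m _ *m _);
      by apply/matrixP => i j; rewrite !mxE mevalC.
  have := @rank_open K m _ _ M x0 R; rewrite ME rQ0 => /(_ (leqnn _))[J1 Jx0 hJ1].
  exists J1; first by apply: contraNneq Jx0 => ->; rewrite meval0.
  by move=> x /hJ1; rewrite ME.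
have [x] : exists x, (D * JQ * \prod_(c <- T1) J c).@[x] != 0.
  apply: (mpoly_nonroot charK); rewrite !mulf_neq0 // prodf_seq_neq0.
  by apply/allP => c _ /=; have [] := hJ c.
rewrite !mevalM !mulf_eq0 !negb_or -andbA => /and3P[/hD Ffree /hJQ rQ].
rewrite rmorph_prod prodf_seq_neq0 => /allP JT.
have {}JT : {in T1, forall c, (n * R <= \rank (A x + c *: B x)%R)%N}.
  by move=> c /JT /= Jc; have [_] := hJ c; apply.
have [LL LQ] := ker_isotropic JT; set L := (\sum_(c <- T1) _)%MS in LL LQ.
have FL : (jac F x <= L)%MS.
  apply/row_subP => i; rewrite rowK; apply: submx_trans (hT i x) _.
  apply: seq_sumsmx_sub => c cT; apply: (@seq_sumsmx_sup _ _ _ _ (fun c => kermx (A x + c *: B x))).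
  rewrite inE; apply/orP; right; apply/flatten_mapP; exists i => //.
  by rewrite mem_enum.
have := isotropic_rank_le (A_skew x) LL LQ.
have := mxrankS FL; rewrite (eqP Ffree).
have := JT 0 (mem_head _ _); rewrite scale0r addr0.
move: rQ; move: (\rank _) (\rank _) (\rank _) => a b c.
by move: (n * R)%N; lia.
Qed.

Section Lower.
Variables (x : 'I_m -> K) (S : seq K) (rs : K -> seq K) (F0 : r0.-tuple (symalg q)).
Hypothesis rk : forall c, \rank (A x + c *: B x)%R = (n * R)%N.
Hypothesis rkB : (n.-1 * R <= \rank (B x))%N.
Hypothesis rkQ : \rank (Q *m A x *m Q^T) = R.
Hypotheses (uS : uniq S) (S0 : 0 \notin S) (sS : (m < size S)%N).
Hypothesis good : {in S, forall c, [/\ uniq (rs c), size (rs c) = n &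
  p + c *: l = \prod_(z <- rs c) ('X - z%:P)]}.
Hypothesis invF0 : forall a, sym_invariants br (tnth F0 a).
Local Notation cof c k := (lprod (rs c) k * rprod (rs c) k).
Hypothesis freeF0 : {in S, forall c, forall k : 'I_n, row_free (jac F0 (current_at x (cof c k)))}.

Let I := ('I_(size S) * ('I_n * 'I_r0))%type.
(** For each parameter c in S, the invariants of q transported to the n copies
    of q in q[t]/(p + c l). *)
Let gen (t : I) : symalg W := sym_tens n (tnth F0 t.2.2) (cof S`_t.1 t.2.1).

Lemma gen_in t : @Zpencil K q br n p (p + l) (gen t).
Proof.
have cS : S`_t.1 \in S by rewrite mem_nth.
have [_ srs rsE] := good cS.
apply: gen_base; exists (1 - S`_t.1).
have -> : (1 - S`_t.1) *: p + (1 - (1 - S`_t.1)) *: (p + l) = p + S`_t.1 *: l.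
  by rewrite subKr scalerDr addrA -scalerDl subrK scale1r.
by rewrite /Zmod rsE; apply: (sym_tens_centre skbr srs charK).
Qed.

(** At x the differentials of the generators at parameter c span the kernel
    of A + c B, since they are independent and as many as its dimension. So
    the rank of all the differentials is at least the dimension of the sum of
    these kernels, which [pencil_sum_ker] bounds from below. A maximal
    independent subfamily is algebraically independent. *)
Lemma Zpencil_indep_ex : exists d (F : d.-tuple (symalg W)),
  [/\ forall i, @Zpencil K q br n p (p + l) (tnth F i), alg_indep F &
      (m + m <= 2 * d + n * R + R)%N].
Proof.
pose L : 'M[K]_(#|{: I}|, m) := \matrix_a grad (gen (enum_val a)) x.
have SL : {in S, forall c, (kermx (A x + c *: B x) <= L)%MS}.
  move=> c cS; have [urs srs rsE] := good cS.
  have [t tc] : exists t : 'I_(size S), S`_t = c.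
    by exists (Ordinal (etrans (index_mem c S) cS)); rewrite /= nth_index.
  have := @cofactor_kermx K q br n skbr (rs c) srs r0 (fun k => jac F0 (current_at x (cof c k))) x urs.
  case=> [k|k|].
  - exact: freeF0.
  - by apply/row_matrixP => a; rewrite row_mul rowK row0 (invariants_grad (invF0 a)).
  set D := \matrix_(_ < _) _ => Dfree; rewrite -rsE gram_affine // => /sub_kermxP sD.
  have eD : (D == kermx (A x + c *: B x)%R)%MS.
    rewrite -(mxrank_leqif_eq sD) (eqP Dfree) mxrank_ker rk card_prod !card_ord dim_W.
    by rewrite mulnBr subKn // leq_mul2l ind_leq // orbT.
  case/andP: eD => _ sKD; apply: submx_trans sKD _; apply/row_subP => b; rewrite rowK.
  move: (enum_val b) => [k a] /=.
  have -> : coord_row (tens n (vec_of (row a (jac F0 (current_at x (cof c k))))) (cof c k)) = row (enum_rank (t, (k, a))) L.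
    by rewrite !rowK enum_rankK /gen /= tc grad_sym_tens.
  exact: row_sub.
have bound : (m + m <= 2 * \rank L + n * R + R)%N.
  rewrite -[X in (_ <= _ + X)%N]rkQ.
  apply: (pencil_sum_ker charK (A_skew x) (B_skew x) rk _ (QB x) uS S0 sS SL).
  rewrite rkQ; apply: leq_trans (leq_add rkB (leqnn _)).
  by case: n n_ge2 => // k _; rewrite /= mulSn addnC.
exists (\rank L), [tuple gen (enum_val (maxrankfun L j)) | j < \rank L]; split=> //.
  by move=> i; rewrite tnth_mktuple; apply: gen_in.
apply: (jac_alg_indep charK (x := x)).
have -> : jac [tuple gen (enum_val (maxrankfun L j)) | j < \rank L] x = rowsub (maxrankfun L) L.
  by apply/row_matrixP => j; rewrite row_rowsub !rowK tnth_mktuple.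
exact: maxrowsub_free.
Qed.
End Lower.
End Bounds.

Lemma b_lie_n_eq (K : fieldType) (q : vectType K) (br : q -> q -> q) n d :
  (ind br <= \dim {:q})%N ->
  (2 * d + n * (\dim {:q} - ind br) + (\dim {:q} - ind br) = n * \dim {:q} + n * \dim {:q})%N ->
  d%:R = b_lie_n br n.
Proof.
rewrite /b_lie_n /b_lie; move: (\dim _) (ind br) => N i le_iN.
have [R ->] : exists R, N = (i + R)%N by exists (N - i)%N; rewrite subnKC.
rewrite addKn => h.
have {}h : 2 * d%:R + n%:R * R%:R + R%:R = n%:R * (i%:R + R%:R) + n%:R * (i%:R + R%:R) :> rat.
  by rewrite -!(natrD, natrM) h.
have -> : d%:R = (n%:R * (i%:R + R%:R) + n%:R * (i%:R + R%:R) - R%:R - n%:R * R%:R) / 2 :> rat.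
  by rewrite -h; field.
by rewrite natrD; field.
Qed.

Unset Implicit Arguments.

Theorem theorem3p7 (K : closedFieldType) (charK : [pchar K] =i pred0)
    (q : vectType K) (br : q -> q -> q) (lie_br : is_lie_bracket br)
    (nonab : exists x y : q, br x y <> 0)
    (n : nat) (n_ge2 : (2 <= n)%N)
    (trdeg_inv : has_trdeg (sym_invariants br) (ind br))
    (codim2 : codim_property br 2)
    (p l : {poly K}) (p_monic : p \is monic) (deg_p : size p = n.+1)
    (l_neq0 : l <> 0) (deg_l : (size l <= 2)%N) :
  exists d : nat,
    has_trdeg (@Zpencil K q br n p (p + l)) d /\ d%:R = b_lie_n br n.
Proof.
have {l_neq0}/eqP nzl := l_neq0.
have [[F0 [invF0 indF0]] _] := trdeg_inv.
have [J nzJ hJ] := alg_indep_jac charK indF0.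
have [v reg_v] := ind_regular lie_br.
have [G nzG hG] := regular_lines lie_br charK codim2 v.
have [mu mu_l] := linear_form_neq0 nzl deg_l.
have [T0 hT0] := separable_pencil charK n_ge2 p_monic deg_p nzl deg_l.
(* More parameters than dim W are needed in [pencil_sum_ker]; 0 is avoided so
   that they can be inverted there. *)
have [S [uS sS ST]] := many_scalars charK (\dim {:Wspace q n}).+1 (0 :: T0).
have S0 : 0 \notin S by apply/negP => /ST; rewrite mem_head.
have /choice[rs hrs] : forall c, exists rs : seq K, c \in S ->
    [/\ uniq rs, size rs = n & p + c *: l = \prod_(z <- rs) ('X - z%:P)].
  move=> c; case: (boolP (c \in S)) => [cS|_]; last by exists [::].
  have /hT0[rs rsE] : c \notin T0.
    by have := ST _ cS; rewrite inE negb_or => /andP[].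
  by exists rs.
pose cof c k := lprod (rs c) k * rprod (rs c) k.
pose slope c k := (cof c k)`_0 + mu * (cof c k)`_1.
(* At the special point, the points of the dual of q given by the cofactors of
   p + c l are u + slope c k * v; the invariants must have independent
   differentials there, which are finitely many generic conditions on u. *)
pose Js c k : {mpoly K[\dim {:q}]} :=
  J \mPo [tuple 'X_i + (slope c k * v i)%:MP | i < \dim {:q}].
have JsE c k u : (Js c k).@[u] = J.@[fun i => u i + slope c k * v i].
  rewrite comp_mpoly_meval; apply: meval_eq => i.
  by rewrite tnth_mktuple mevalD mevalXU mevalC.
have nzJs c k : Js c k != 0.
  have [z] := mpoly_nonroot charK nzJ; apply: contraNneq => Js0.
  have := JsE c k (fun i => z i - slope c k * v i); rewrite Js0 meval0 => h.
  by apply/eqP; rewrite [RHS]h; apply: meval_eq => i; rewrite subrK.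
have [u] : exists u, (G * \prod_(c <- S) \prod_(k < n) Js c k).@[u] != 0.
  apply: (mpoly_nonroot charK); rewrite mulf_neq0 // prodf_seq_neq0.
  by apply/allP => c _ /=; apply/prodf_neq0 => k _.
rewrite mevalM mulf_eq0 negb_or => /andP[/hG reg_uv].
rewrite rmorph_prod prodf_seq_neq0 => /allP uJ.
have {}uJ c (k : 'I_n) : c \in S -> J.@[fun i => u i + slope c k * v i] != 0.
  by move=> /uJ /=; rewrite -JsE rmorph_prod => /prodf_neq0; apply.
have [x current_x] := special_point n_ge2 u v mu.
have rkA := form_rank_point charK lie_br n_ge2 p_monic deg_p nzl deg_l reg_uv current_x.
have rkB := gram_slope_rank_point lie_br p_monic deg_p mu_l reg_v reg_uv current_x.
have rkQ := const_currents_rank_point lie_br n_ge2 deg_p reg_v current_x.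
have [||d [F [FZ indF hd]]] :=
  Zpencil_indep_ex charK lie_br n_ge2 p_monic deg_p deg_l rkA rkB rkQ uS S0 _ hrs invF0.
- by rewrite sS.
- move=> c cS k; apply: hJ; have [_ srs _] := hrs c cS.
  by rewrite (current_cofactor current_x) // uJ.
have upper k (F1 : k.-tuple (symalg (Wspace q n))) F1Z indF1 :=
  Zpencil_indep_le charK lie_br n_ge2 p_monic deg_p nzl deg_l (F := F1) rkA rkQ F1Z indF1.
exists d; split.
  split; first by exists F.
  move=> k F1 F1Z indF1; have := upper k F1 F1Z indF1; move: hd.
  by move: (n * _)%N (_ + _)%N => a b; lia.
apply: b_lie_n_eq; first exact: ind_leq.
by apply/eqP; rewrite -!dim_W eqn_leq hd (upper d F FZ indF).
Qed.
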